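(* None of the examples in the list given in the context is (pseudo-)Kähler, in the sense of a (pseudo-)Kähler Ricci soliton. That is, let $M=G/H$ be any of the four-dimensional homogeneous spaces in the list, let $g$ be an invariant non-Einstein pseudo-Riemannian metric on $M$ (subject to the metric condition indicated in the list, if any), and let $X\in\mathfrak m$ and $\lambda\in\mathbb R$ satisfy the Ricci soliton equation $\mathcal L_Xg+\varrho=\lambda g$. Then there is no invariant complex structure $J$ on $M$ such that $(g,J)$ is (pseudo-)Kähler and $X$ is holomorphic, i.e. $\mathcal L_XJ=0$.
   Context: A four-dimensional pseudo-Riemannian homogeneous space $M=G/H$ with non-trivial isotropy ($H$ connected) is described locally by a pair $(\mathfrak g,\mathfrak h)$, where $\mathfrak g$ is the Lie algebra of $G$, $\mathfrak h\neq0$ that of the stabilizer $H$, and $\mathfrak m\cong\mathfrak g/\mathfrak h$, $\dim\mathfrak m=4$, is identified with a complement of $\mathfrak h$ in $\mathfrak g$; $x_{\mathfrak m}$ denotes the $\mathfrak m$-component. The isotropy representation is $\psi(x)(y)=[x,y]_{\mathfrak m}$, $x\in\mathfrak h$, $y\in\mathfrak m$. An invariant pseudo-Riemannian metric is a nondegenerate symmetric bilinear form $g$ on $\mathfrak m$ with $g(\psi(x)y,z)+g(y,\psi(x)z)=0$ for all $x\in\mathfrak h$, $y,z\in\mathfrak m$. Its Levi-Civita connection is $\Lambda:\mathfrak g\to\mathfrak{gl}(\mathfrak m)$, $\Lambda(x)(y_{\mathfrak m})=\frac12[x,y]_{\mathfrak m}+v(x,y)$, with $v$ symmetric and $2g(v(x,y),z_{\mathfrak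 m})=g(x_{\mathfrak m},[z,y]_{\mathfrak m})+g(y_{\mathfrak m},[z,x]_{\mathfrak m})$; the curvature is $R(x,y)=[\Lambda(x),\Lambda(y)]-\Lambda([x,y])$ and $\varrho$ is the Ricci tensor. For $X\in\mathfrak m$ the Ricci soliton equation reads $g([X,u_i]_{\mathfrak m},u_j)+g(u_i,[X,u_j]_{\mathfrak m})+\varrho(u_i,u_j)=\lambda g(u_i,u_j)$ for all $i,j$. The pair $(g,J)$ is (pseudo-)Kähler if $J$ is a complex structure with $g(J\cdot,J\cdot)=g$ and $J$ parallel for the Levi-Civita connection of $g$. The list consists of the four-dimensional homogeneous spaces with non-trivial isotropy that admit a non-trivial (non-Einstein) homogeneous Ricci soliton with $X\in\mathfrak m$. Each label $n.m^k.q$ is that of a pair $(\mathfrak g,\mathfrak h)$ in Komrakov's classification; $\{e_i\}$ is a basis of $\mathfrak h$, $\{u_i\}$ a basis of $\mathfrak m$, $\{\theta_i\}$ the dual basis of $\{u_i\}$, $\theta_i\circ\theta_j=\frac12(\theta_i\otimes\theta_j+\theta_j\otimes\theta_i)$, $\theta_i^2=\theta_i\circ\theta_i$. Parameters are real. Brackets between elements of $\mathfrak h$ are not displayed. Type $1.1^1$ ($[e_1,u_1]=u_1$, $[e_1,u_3]=-u_3$; metrics $g=a\theta_1\circ\theta_3+b\theta_2^2+c\theta_2\circ\theta_4+d\theta_4^2$, $a(bd-c^2)\neq0$): $1.1^1.1$: $[u_1,u_3]=u_2$, $[u_2,u_4]=u_2$, $[u_3,u_4]=u_3$; with metric condition $b=0\neq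 d$; $1.1^1.2$: $[u_2,u_4]=pu_2$, $[u_3,u_4]=u_3$; $p\neq\frac12$; $1.1^1.5$: $[u_1,u_3]=e_1$, $[u_2,u_4]=u_2$. Type $1.1^2$ ($[e_1,u_1]=u_3$, $[e_1,u_3]=-u_1$): $1.1^2.1$: $[u_1,u_3]=-u_2$, $[u_1,u_4]=u_1$, $[u_2,u_4]=2u_2$, $[u_3,u_4]=u_3$; $1.1^2.2$: $[u_1,u_4]=u_1$, $[u_2,u_4]=pu_2$, $[u_3,u_4]=u_3$; $p\neq1$; $1.1^2.6$, $1.1^2.7$: $[u_1,u_3]=\varepsilon e_1$, $[u_2,u_4]=u_2$; $\varepsilon=1,-1$ respectively. Type $1.3^1$ ($[e_1,u_3]=u_1$, $[e_1,u_4]=u_2$): $1.3^1.1$: $[u_1,u_2]=-\frac12u_2$, $[u_1,u_3]=u_1$, $[u_1,u_4]=\frac12u_4$, $[u_2,u_3]=\frac12u_4$; $1.3^1.2$ (with its parameter $p=0$): $[u_1,u_3]=u_1$, $[u_2,u_4]=u_2$; $1.3^1.3$: $[u_1,u_3]=u_1$, $[u_2,u_4]=u_2$, $[u_3,u_4]=e_1$; $1.3^1.5$ (with its parameter $q=0$): $[u_1,u_3]=p^2e_1-(1+p^2)u_2$, $[u_1,u_4]=[u_2,u_3]=pe_1+u_1+pu_2$, $[u_2,u_4]=u_2$; $p\ge0$; $1.3^1.6$: $[u_1,u_3]=-u_2$, $[u_1,u_4]=u_1$, $[u_2,u_3]=u_1$, $[u_2,u_4]=u_2$, $[u_3,u_4]=e_1$;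 $1.3^1.7$ (with its parameter $p=0$): $[u_1,u_3]=e_1-u_2$, $[u_1,u_4]=[u_2,u_3]=-e_1+u_1+u_2$, $[u_2,u_4]=u_2$; $1.3^1.8$: $[u_2,u_3]=u_1$, $[u_2,u_4]=u_2$, $[u_3,u_4]=-u_3$; $1.3^1.9$: $[u_2,u_3]=pu_1$, $[u_2,u_4]=-pe_1+(p+1)u_2$, $[u_3,u_4]=-pu_3$; $p\neq0$, $p\neq1$; $1.3^1.11$: $[u_2,u_3]=-u_1$, $[u_2,u_4]=e_1$, $[u_3,u_4]=e_1+u_3$; $1.3^1.12$: $[u_1,u_4]=u_1$, $[u_2,u_3]=qu_1$, $[u_2,u_4]=-pqe_1+(p+q)u_2$, $[u_3,u_4]=(1-q)u_3$; $p,q\in\mathbb R$; $1.3^1.13$: $[u_1,u_4]=u_1$, $[u_2,u_3]=\frac12u_1$, $[u_2,u_4]=-\frac p2e_1+(p+\frac12)u_2$, $[u_3,u_4]=e_1+\frac12u_3$; $p=0$ or $4p^2-4p-3\neq0$; $1.3^1.14$: $[u_1,u_4]=u_1$, $[u_2,u_3]=(1-p)u_1$, $[u_2,u_4]=p(p-1)e_1+u_2$, $[u_3,u_4]=e_1+pu_3$; $p\neq\frac12$, $p(p-1)\neq0$; $1.3^1.19$: $[u_1,u_4]=u_1$, $[u_2,u_3]=u_1$, $[u_2,u_4]=-e_1+u_1+2u_2$; $1.3^1.20$: $[u_2,u_3]=u_1$, $[u_2,u_4]=-u_1+u_2$, $[u_3,u_4]=-u_3$; $1.3^1.21$: $[u_1,u_4]=u_1$,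 $[u_2,u_3]=pu_1$, $[u_2,u_4]=-pe_1+(1-p)u_1+(1+p)u_2$, $[u_3,u_4]=(1-p)u_3$; $p\neq1$, $p(p-2)\neq0$; $1.3^1.22$: $[u_1,u_4]=u_1$, $[u_2,u_3]=\frac12u_1$, $[u_2,u_4]=-\frac12e_1+\frac12u_1+\frac32u_2$, $[u_3,u_4]=e_1+\frac12u_3$; $1.3^1.28$: $[u_1,u_3]=2u_1$, $[u_1,u_4]=2u_2$, $[u_2,u_3]=u_2$, $[u_2,u_4]=e_1-\frac12u_1$, $[u_3,u_4]=u_4$. Type $1.4^1$ ($[e_1,u_2]=u_1$, $[e_1,u_3]=u_2$): $1.4^1.2$ (with its parameter $p=1$): $[u_1,u_4]=u_1$, $[u_2,u_4]=0$, $[u_3,u_4]=-u_3$; $1.4^1.9$: $[u_1,u_3]=u_1$, $[u_2,u_3]=re_1+u_2+u_4$, $[u_3,u_4]=pu_4$; $p,r\in\mathbb R$; $1.4^1.10$: $[u_1,u_3]=u_1$, $[u_2,u_3]=re_1+u_2$, $[u_3,u_4]=pu_4$; $r+p(p+1)\neq0$; $1.4^1.12$: $[u_1,u_3]=u_1$, $[u_2,u_3]=re_1+u_2$, $[u_3,u_4]=u_1-u_4$; $r\in\mathbb R$; $1.4^1.15$, $1.4^1.16$, $1.4^1.17$: $[u_2,u_3]=\varepsilon e_1+u_4$, $[u_3,u_4]=u_1$; $\varepsilon=1,-1,0$; $1.4^1.21$, $1.4^1.22$: $[u_2,u_3]=\varepsilon e_1$, $[u_3,u_4]=u_1$; $\varepsilon=1,-1$.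 Type $2.2^1$ ($[e_1,u_1]=u_1$, $[e_1,u_3]=-u_3$, $[e_2,u_2]=u_1$, $[e_2,u_3]=-u_4$): $2.2^1.2$: $[u_1,u_2]=e_2$, $[u_1,u_3]=u_4$, $[u_2,u_3]=(p-1)u_3$, $[u_2,u_4]=pu_4$; $p\neq\pm2$; $2.2^1.3$: $[u_2,u_3]=u_3$, $[u_2,u_4]=u_4$. Type $2.5^1$ ($[e_1,u_2]=u_1$, $[e_1,u_3]=-u_4$, $[e_2,u_3]=-u_2$, $[e_2,u_4]=u_1$): $2.5^1.3$: $[u_1,u_3]=u_1$, $[u_2,u_3]=e_1+re_2+(1-h)u_2$, $[u_2,u_4]=hu_1$, $[u_3,u_4]=-(r+h)e_1+se_2-(1+h)u_4$; $h\ge0$ if $s\neq0$, $2r+h-\frac12h^2\neq0$; $2.5^1.4$: $[u_1,u_3]=u_1$, $[u_2,u_3]=re_2+(1-h)u_2$, $[u_2,u_4]=hu_1$, $[u_3,u_4]=-(r+h)e_1-(1+h)u_4$; $h\ge0$, $2r+h-\frac12h^2\neq0$. $2.5^2.2$: $[e_1,u_2]=u_1$, $[e_1,u_3]=-u_2$, $[e_2,u_3]=u_4$, $[e_2,u_4]=-u_1$, $[u_1,u_3]=u_1$, $[u_2,u_3]=(p+s)e_1+re_2+u_2-2ru_4$, $[u_2,u_4]=2ru_1$, $[u_3,u_4]=-re_1+(p-s)e_2-2ru_2-u_4$; $r,s\ge0$, $p\neq-r^2$. $3.3^1.1$: $[e_1,u_2]=u_2$, $[e_1,u_4]=-u_4$,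 $[e_2,u_2]=u_1$, $[e_2,u_3]=-u_4$, $[e_3,u_3]=-u_2$, $[e_3,u_4]=u_1$, $[u_1,u_3]=u_1$, $[u_2,u_3]=pe_3+u_2$, $[u_3,u_4]=-pe_2-u_4$; $p\neq0$. $3.3^2.1$: $[e_1,u_2]=u_4$, $[e_1,u_4]=-u_2$, $[e_2,u_2]=u_1$, $[e_2,u_3]=-u_2$, $[e_3,u_3]=u_4$, $[e_3,u_4]=-u_1$, $[u_1,u_3]=u_1$, $[u_2,u_3]=pe_2+u_2$, $[u_3,u_4]=pe_3-u_4$; $p\neq0$. *)

(* Defs.v *)
From HB Require Import structures.
From mathcomp Require Import all_boot all_order all_algebra reals.

Set Implicit Arguments.
Unset Strict Implicit.
Unset Printing Implicit Defensive.

Import Order.TTheory GRing.Theory Num.Theory.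
Local Open Scope ring_scope.

(* A pair (g, h) with dim h = r and dim m = 4 is given in coordinates:
   g = 'rV_(r + 4), where the first r coordinates span h (basis e_i) and the
   last four span the complement m (basis u_i).  The complement is not assumed
   to be reductive.  Basis indices are 1-based naturals, as in Komrakov's
   tables. *)
Definition inh (R : realType) (r : nat) (x : 'rV[R]_r) : 'rV[R]_(r + 4) :=
  row_mx x 0.
Definition inm (R : realType) (r : nat) (y : 'rV[R]_4) : 'rV[R]_(r + 4) :=
  row_mx 0 y.
Definition mpart (R : realType) (r : nat) (x : 'rV[R]_(r + 4)) : 'rV[R]_4 :=
  rsubmx x.

Definition eh (R : realType) (r i : nat) : 'rV[R]_r := \row_k (k.+1 == i)%:R.
Definition um (R : realType) (i : nat) : 'rV[R]_4 := \row_k (k.+1 == i)%:R.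
Definition e_ (R : realType) (r i : nat) : 'rV[R]_(r + 4) := inh (eh R r i).
Definition u_ (R : realType) (r i : nat) : 'rV[R]_(r + 4) := inm r (um R i).
Arguments inm {R r}.
Arguments eh {R r}.
Arguments um {R}.
Arguments e_ {R r}.
Arguments u_ {R r}.

(* The item [brk i j v] of a table records the bracket of the i-th and the j-th
   basis vectors; pairs that do not occur have bracket 0. *)
Definition brk (V : Type) (i j : nat) (v : V) : nat * nat * V := (i, j, v).

Definition table_val (V : nmodType) (t : seq (nat * nat * V)) (i j : nat) : V :=
  \sum_(x <- t | x.1 == (i, j)) x.2.

(* [iso_table] lists the [e_i, u_j] modulo h, and [m_table] lists the
   [u_i, u_j], one of (i, j) and (j, i) being recorded. *)
Record komrakov_pair (R : realType) := KomrakovPair {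
  hdim : nat;
  iso_table : seq (nat * nat * 'rV[R]_(hdim + 4));
  m_table : seq (nat * nat * 'rV[R]_(hdim + 4));
  metric_cond : 'M[R]_4 -> Prop }.

Definition lie_bracket (V : zmodType) (br : V -> V -> V) : Prop :=
  (forall x, br x x = 0) /\
  (forall x y z, br x (br y z) + br y (br z x) + br z (br x y) = 0).

(* [br] is a Lie algebra structure on g for which h is a subalgebra and which
   has the brackets of the tables.  The brackets inside h and the h-components
   of the [e_i, u_j] do not belong to the tables; they are only constrained by
   the Jacobi identity.  In 1.4^1.2, for instance, it forces [e_1, u_4] = e_1. *)
Definition realizes (R : realType) (P : komrakov_pair R)
    (br : 'rV[R]_(hdim P + 4) -> 'rV[R]_(hdim P + 4) -> 'rV[R]_(hdim P + 4)) :
    Prop :=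
  [/\ lie_bracket br,
      forall x y : 'rV[R]_(hdim P), mpart (br (inh x) (inh y)) = 0,
      forall (i : 'I_(hdim P)) (j : 'I_4),
        mpart (br (e_ i.+1) (u_ j.+1))
          = mpart (table_val (iso_table P) i.+1 j.+1)
    & forall i j : 'I_4,
        br (u_ i.+1) (u_ j.+1)
          = table_val (m_table P) i.+1 j.+1 - table_val (m_table P) j.+1 i.+1].

Arguments realizes {R} P br.

Definition isotropy (R : realType) (r : nat)
    (br : 'rV[R]_(r + 4) -> 'rV[R]_(r + 4) -> 'rV[R]_(r + 4))
    (x : 'rV[R]_r) (y : 'rV[R]_4) : 'rV[R]_4 :=
  mpart (br (inh x) (inm y)).

Definition mbr (R : realType) (r : nat)
    (br : 'rV[R]_(r + 4) -> 'rV[R]_(r + 4) -> 'rV[R]_(r + 4))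
    (x y : 'rV[R]_4) : 'rV[R]_4 :=
  mpart (br (inm x) (inm y)).

(* A bilinear form on m is represented by its Gram matrix in the basis u_i. *)
Definition gm (R : realType) (G : 'M[R]_4) (x y : 'rV[R]_4) : R :=
  (x *m G *m y^T) 0 0.

Definition invariant_metric (R : realType) (r : nat)
    (br : 'rV[R]_(r + 4) -> 'rV[R]_(r + 4) -> 'rV[R]_(r + 4))
    (G : 'M[R]_4) : Prop :=
  [/\ G^T = G, G \in unitmx
    & forall (x : 'rV[R]_r) (y z : 'rV[R]_4),
        gm G (isotropy br x y) z + gm G y (isotropy br x z) = 0].

(* The vector v(x, y) of m that satisfies
   2 g(v(x, y), z) = g(x_m, [z, y]_m) + g(y_m, [z, x]_m) for z in m:
   see [two_gm_lc_v] below. *)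
Definition lc_v (R : realType) (r : nat)
    (br : 'rV[R]_(r + 4) -> 'rV[R]_(r + 4) -> 'rV[R]_(r + 4))
    (G : 'M[R]_4) (x y : 'rV[R]_(r + 4)) : 'rV[R]_4 :=
  (\row_(k < 4) (2^-1 * (gm G (mpart x) (mpart (br (u_ k.+1) y))
                         + gm G (mpart y) (mpart (br (u_ k.+1) x)))))
  *m invmx G.

Definition levi_civita (R : realType) (r : nat)
    (br : 'rV[R]_(r + 4) -> 'rV[R]_(r + 4) -> 'rV[R]_(r + 4))
    (G : 'M[R]_4) (x : 'rV[R]_(r + 4)) (y : 'rV[R]_4) : 'rV[R]_4 :=
  2^-1 *: mpart (br x (inm y)) + lc_v br G x (inm y).

Definition curvature (R : realType) (r : nat)
    (br : 'rV[R]_(r + 4) -> 'rV[R]_(r + 4) -> 'rV[R]_(r + 4))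
    (G : 'M[R]_4) (x y : 'rV[R]_(r + 4)) (z : 'rV[R]_4) : 'rV[R]_4 :=
  levi_civita br G x (levi_civita br G y z)
  - levi_civita br G y (levi_civita br G x z)
  - levi_civita br G (br x y) z.

(* Ric(y, z) is the trace of x |-> R(x, y) z, so that round spheres have
   positive Ricci curvature. *)
Definition ricci (R : realType) (r : nat)
    (br : 'rV[R]_(r + 4) -> 'rV[R]_(r + 4) -> 'rV[R]_(r + 4))
    (G : 'M[R]_4) (y z : 'rV[R]_4) : R :=
  \tr (lin1_mx (fun x : 'rV[R]_4 => curvature br G (inm x) (inm y) z)).

Definition einstein (R : realType) (r : nat)
    (br : 'rV[R]_(r + 4) -> 'rV[R]_(r + 4) -> 'rV[R]_(r + 4))
    (G : 'M[R]_4) : Prop :=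
  exists c : R, forall y z : 'rV[R]_4, ricci br G y z = c * gm G y z.

Definition ricci_soliton (R : realType) (r : nat)
    (br : 'rV[R]_(r + 4) -> 'rV[R]_(r + 4) -> 'rV[R]_(r + 4))
    (G : 'M[R]_4) (X : 'rV[R]_4) (lambda : R) : Prop :=
  forall i j : 'I_4,
    gm G (mbr br X (um i.+1)) (um j.+1) + gm G (um i.+1) (mbr br X (um j.+1))
      + ricci br G (um i.+1) (um j.+1)
    = lambda * gm G (um i.+1) (um j.+1).

(* An endomorphism of m is given by a matrix acting on row vectors, J y being
   y *m J.  The last condition is the vanishing of the Nijenhuis tensor. *)
Definition invariant_complex_structure (R : realType) (r : nat)
    (br : 'rV[R]_(r + 4) -> 'rV[R]_(r + 4) -> 'rV[R]_(r + 4))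
    (J : 'M[R]_4) : Prop :=
  [/\ J *m J = - 1%:M,
      forall (x : 'rV[R]_r) (y : 'rV[R]_4),
        isotropy br x (y *m J) = isotropy br x y *m J
    & forall x y : 'rV[R]_4,
        mbr br (x *m J) (y *m J) - mbr br x (y *m J) *m J
          - mbr br (x *m J) y *m J - mbr br x y = 0].

Definition kahler (R : realType) (r : nat)
    (br : 'rV[R]_(r + 4) -> 'rV[R]_(r + 4) -> 'rV[R]_(r + 4))
    (G J : 'M[R]_4) : Prop :=
  [/\ invariant_complex_structure br J,
      forall y z : 'rV[R]_4, gm G (y *m J) (z *m J) = gm G y z
    & forall (x : 'rV[R]_(r + 4)) (y : 'rV[R]_4),
        levi_civita br G x (y *m J) = levi_civita br G x y *m J].

(* L_X J = 0, with (L_X J) y = [X, J y]_m - J [X, y]_m. *)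
Definition holomorphic (R : realType) (r : nat)
    (br : 'rV[R]_(r + 4) -> 'rV[R]_(r + 4) -> 'rV[R]_(r + 4))
    (X : 'rV[R]_4) (J : 'M[R]_4) : Prop :=
  forall y : 'rV[R]_4, mbr br X (y *m J) = mbr br X y *m J.

Lemma two_gm_lc_v (R : realType) (r : nat)
    (br : {bilinear 'rV[R]_(r + 4) -> 'rV[R]_(r + 4) -> 'rV[R]_(r + 4)})
    (G : 'M[R]_4) (x y : 'rV[R]_(r + 4)) (z : 'rV[R]_4) : G \in unitmx ->
  2 * gm G (lc_v br G x y) z = gm G (mpart x) (mpart (br (inm z) y))
                               + gm G (mpart y) (mpart (br (inm z) x)).
Proof.
move=> Gu; rewrite {1}/gm /lc_v mulmxKV // mxE mulr_sumr.
have zE : inm z = \sum_(k < 4) z 0 k *: u_ k.+1 :> 'rV[R]_(r + 4).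
  apply/rowP=> j; rewrite summxE /inm /u_.
  case: (split_ordP j) => i ->.
    by rewrite row_mxEl mxE big1 // => k _; rewrite mxE row_mxEl mxE mulr0.
  rewrite row_mxEr (bigD1 i) //= mxE row_mxEr mxE eqxx mulr1 big1 ?addr0 //.
  move=> k ki; rewrite mxE row_mxEr mxE eqSS.
  by rewrite (inj_eq val_inj) eq_sym (negPf ki) mulr0.
have expand (a : 'rV[R]_4) (w : 'rV[R]_(r + 4)) : gm G a (mpart (br (inm z) w))
    = \sum_(k < 4) z 0 k * gm G a (mpart (br (u_ k.+1) w)).
  rewrite zE linear_sumlz /mpart linear_sum /gm linear_sum mulmx_sumr summxE.
  by apply: eq_bigr => k _; rewrite linearZl_LR /= !linearZ /= mxE.
rewrite !expand -big_split /=; apply: eq_bigr => k _.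
rewrite !mxE -mulrDr [_ * z 0 k]mulrC mulrCA; congr (_ * _).
by rewrite mulrA mulfV ?mul1r // pnatr_eq0.
Qed.

Definition kpair (R : realType) (r : nat)
    (iso tab : seq (nat * nat * 'rV[R]_(r + 4))) : komrakov_pair R :=
  KomrakovPair iso tab (fun=> True).

Definition iso11_1 (R : realType) : seq (nat * nat * 'rV[R]_(1 + 4)) :=
  [:: brk 1 1 (u_ 1); brk 1 3 (- u_ 3)].
Definition iso11_2 (R : realType) : seq (nat * nat * 'rV[R]_(1 + 4)) :=
  [:: brk 1 1 (u_ 3); brk 1 3 (- u_ 1)].
Definition iso13_1 (R : realType) : seq (nat * nat * 'rV[R]_(1 + 4)) :=
  [:: brk 1 3 (u_ 1); brk 1 4 (u_ 2)].
Definition iso14_1 (R : realType) : seq (nat * nat * 'rV[R]_(1 + 4)) :=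
  [:: brk 1 2 (u_ 1); brk 1 3 (u_ 2)].
Definition iso22_1 (R : realType) : seq (nat * nat * 'rV[R]_(2 + 4)) :=
  [:: brk 1 1 (u_ 1); brk 1 3 (- u_ 3); brk 2 2 (u_ 1); brk 2 3 (- u_ 4)].
Definition iso25_1 (R : realType) : seq (nat * nat * 'rV[R]_(2 + 4)) :=
  [:: brk 1 2 (u_ 1); brk 1 3 (- u_ 4); brk 2 3 (- u_ 2); brk 2 4 (u_ 1)].
Definition iso25_2 (R : realType) : seq (nat * nat * 'rV[R]_(2 + 4)) :=
  [:: brk 1 2 (u_ 1); brk 1 3 (- u_ 2); brk 2 3 (u_ 4); brk 2 4 (- u_ 1)].
Definition iso33_1 (R : realType) : seq (nat * nat * 'rV[R]_(3 + 4)) :=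
  [:: brk 1 2 (u_ 2); brk 1 4 (- u_ 4); brk 2 2 (u_ 1); brk 2 3 (- u_ 4);
      brk 3 3 (- u_ 2); brk 3 4 (u_ 1)].
Definition iso33_2 (R : realType) : seq (nat * nat * 'rV[R]_(3 + 4)) :=
  [:: brk 1 2 (u_ 4); brk 1 4 (- u_ 2); brk 2 2 (u_ 1); brk 2 3 (- u_ 2);
      brk 3 3 (u_ 4); brk 3 4 (- u_ 1)].

(* The constructor K_n_m_k_q stands for the label n.m^k.q.

   With the brackets displayed for 1.3^1.1, and with those displayed for
   1.3^1.5 when p <> 0, no choice of the remaining brackets satisfies the
   Jacobi identity.  Besides the displayed tables, the list has the Lie
   algebras that they are meant to describe: in K_1_3_1_1' the bracket
   [u_1, u_3] is u_3 instead of u_1 (g is then the semidirect product of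
   sl(2, R) and R^2, and [e_1, u_1] = e_1), and in K_1_3_1_5' the coefficient of e_1 in
   [u_1, u_4] = [u_2, u_3] is - p instead of p. *)
Inductive listed (R : realType) : komrakov_pair R -> Prop :=
| K_1_1_1_1 : listed (KomrakovPair (iso11_1 R)
    [:: brk 1 3 (u_ 2); brk 2 4 (u_ 2); brk 3 4 (u_ 3)]
    (fun G => gm G (um 2) (um 2) = 0 /\ gm G (um 4) (um 4) <> 0))
| K_1_1_1_2 (p : R) : p <> 2^-1 -> listed (kpair (iso11_1 R)
    [:: brk 2 4 (p *: u_ 2); brk 3 4 (u_ 3)])
| K_1_1_1_5 : listed (kpair (iso11_1 R)
    [:: brk 1 3 (e_ 1); brk 2 4 (u_ 2)])
| K_1_1_2_1 : listed (kpair (iso11_2 R)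
    [:: brk 1 3 (- u_ 2); brk 1 4 (u_ 1); brk 2 4 (2 *: u_ 2); brk 3 4 (u_ 3)])
| K_1_1_2_2 (p : R) : p <> 1 -> listed (kpair (iso11_2 R)
    [:: brk 1 4 (u_ 1); brk 2 4 (p *: u_ 2); brk 3 4 (u_ 3)])
| K_1_1_2_6 : listed (kpair (iso11_2 R)
    [:: brk 1 3 (e_ 1); brk 2 4 (u_ 2)])
| K_1_1_2_7 : listed (kpair (iso11_2 R)
    [:: brk 1 3 (- e_ 1); brk 2 4 (u_ 2)])
| K_1_3_1_1 : listed (kpair (iso13_1 R)
    [:: brk 1 2 (- 2^-1 *: u_ 2); brk 1 3 (u_ 1); brk 1 4 (2^-1 *: u_ 4);
        brk 2 3 (2^-1 *: u_ 4)])
| K_1_3_1_1' : listed (kpair (iso13_1 R)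
    [:: brk 1 2 (- 2^-1 *: u_ 2); brk 1 3 (u_ 3); brk 1 4 (2^-1 *: u_ 4);
        brk 2 3 (2^-1 *: u_ 4)])
| K_1_3_1_2 : listed (kpair (iso13_1 R)
    [:: brk 1 3 (u_ 1); brk 2 4 (u_ 2)])
| K_1_3_1_3 : listed (kpair (iso13_1 R)
    [:: brk 1 3 (u_ 1); brk 2 4 (u_ 2); brk 3 4 (e_ 1)])
| K_1_3_1_5 (p : R) : 0 <= p -> listed (kpair (iso13_1 R)
    [:: brk 1 3 (p ^+ 2 *: e_ 1 - (1 + p ^+ 2) *: u_ 2);
        brk 1 4 (p *: e_ 1 + u_ 1 + p *: u_ 2);
        brk 2 3 (p *: e_ 1 + u_ 1 + p *: u_ 2); brk 2 4 (u_ 2)])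
| K_1_3_1_5' (p : R) : 0 <= p -> listed (kpair (iso13_1 R)
    [:: brk 1 3 (p ^+ 2 *: e_ 1 - (1 + p ^+ 2) *: u_ 2);
        brk 1 4 (- p *: e_ 1 + u_ 1 + p *: u_ 2);
        brk 2 3 (- p *: e_ 1 + u_ 1 + p *: u_ 2); brk 2 4 (u_ 2)])
| K_1_3_1_6 : listed (kpair (iso13_1 R)
    [:: brk 1 3 (- u_ 2); brk 1 4 (u_ 1); brk 2 3 (u_ 1); brk 2 4 (u_ 2);
        brk 3 4 (e_ 1)])
| K_1_3_1_7 : listed (kpair (iso13_1 R)
    [:: brk 1 3 (e_ 1 - u_ 2); brk 1 4 (- e_ 1 + u_ 1 + u_ 2);
        brk 2 3 (- e_ 1 + u_ 1 + u_ 2); brk 2 4 (u_ 2)])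
| K_1_3_1_8 : listed (kpair (iso13_1 R)
    [:: brk 2 3 (u_ 1); brk 2 4 (u_ 2); brk 3 4 (- u_ 3)])
| K_1_3_1_9 (p : R) : p <> 0 -> p <> 1 -> listed (kpair (iso13_1 R)
    [:: brk 2 3 (p *: u_ 1); brk 2 4 (- p *: e_ 1 + (p + 1) *: u_ 2);
        brk 3 4 (- p *: u_ 3)])
| K_1_3_1_11 : listed (kpair (iso13_1 R)
    [:: brk 2 3 (- u_ 1); brk 2 4 (e_ 1); brk 3 4 (e_ 1 + u_ 3)])
| K_1_3_1_12 (p q : R) : listed (kpair (iso13_1 R)
    [:: brk 1 4 (u_ 1); brk 2 3 (q *: u_ 1);
        brk 2 4 (- (p * q) *: e_ 1 + (p + q) *: u_ 2);
        brk 3 4 ((1 - q) *: u_ 3)])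
| K_1_3_1_13 (p : R) : p = 0 \/ 4 * p ^+ 2 - 4 * p - 3 <> 0 ->
    listed (kpair (iso13_1 R)
    [:: brk 1 4 (u_ 1); brk 2 3 (2^-1 *: u_ 1);
        brk 2 4 (- (p / 2) *: e_ 1 + (p + 2^-1) *: u_ 2);
        brk 3 4 (e_ 1 + 2^-1 *: u_ 3)])
| K_1_3_1_14 (p : R) : p <> 2^-1 -> p * (p - 1) <> 0 ->
    listed (kpair (iso13_1 R)
    [:: brk 1 4 (u_ 1); brk 2 3 ((1 - p) *: u_ 1);
        brk 2 4 ((p * (p - 1)) *: e_ 1 + u_ 2); brk 3 4 (e_ 1 + p *: u_ 3)])
| K_1_3_1_19 : listed (kpair (iso13_1 R)
    [:: brk 1 4 (u_ 1); brk 2 3 (u_ 1); brk 2 4 (- e_ 1 + u_ 1 + 2 *: u_ 2)])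
| K_1_3_1_20 : listed (kpair (iso13_1 R)
    [:: brk 2 3 (u_ 1); brk 2 4 (- u_ 1 + u_ 2); brk 3 4 (- u_ 3)])
| K_1_3_1_21 (p : R) : p <> 1 -> p * (p - 2) <> 0 ->
    listed (kpair (iso13_1 R)
    [:: brk 1 4 (u_ 1); brk 2 3 (p *: u_ 1);
        brk 2 4 (- p *: e_ 1 + (1 - p) *: u_ 1 + (1 + p) *: u_ 2);
        brk 3 4 ((1 - p) *: u_ 3)])
| K_1_3_1_22 : listed (kpair (iso13_1 R)
    [:: brk 1 4 (u_ 1); brk 2 3 (2^-1 *: u_ 1);
        brk 2 4 (- 2^-1 *: e_ 1 + 2^-1 *: u_ 1 + (3 / 2) *: u_ 2);
        brk 3 4 (e_ 1 + 2^-1 *: u_ 3)])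
| K_1_3_1_28 : listed (kpair (iso13_1 R)
    [:: brk 1 3 (2 *: u_ 1); brk 1 4 (2 *: u_ 2); brk 2 3 (u_ 2);
        brk 2 4 (e_ 1 - 2^-1 *: u_ 1); brk 3 4 (u_ 4)])
| K_1_4_1_2 : listed (kpair (iso14_1 R)
    [:: brk 1 4 (u_ 1); brk 3 4 (- u_ 3)])
| K_1_4_1_9 (p r : R) : listed (kpair (iso14_1 R)
    [:: brk 1 3 (u_ 1); brk 2 3 (r *: e_ 1 + u_ 2 + u_ 4);
        brk 3 4 (p *: u_ 4)])
| K_1_4_1_10 (p r : R) : r + p * (p + 1) <> 0 -> listed (kpair (iso14_1 R)
    [:: brk 1 3 (u_ 1); brk 2 3 (r *: e_ 1 + u_ 2); brk 3 4 (p *: u_ 4)])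
| K_1_4_1_12 (r : R) : listed (kpair (iso14_1 R)
    [:: brk 1 3 (u_ 1); brk 2 3 (r *: e_ 1 + u_ 2); brk 3 4 (u_ 1 - u_ 4)])
| K_1_4_1_15 : listed (kpair (iso14_1 R)
    [:: brk 2 3 (e_ 1 + u_ 4); brk 3 4 (u_ 1)])
| K_1_4_1_16 : listed (kpair (iso14_1 R)
    [:: brk 2 3 (- e_ 1 + u_ 4); brk 3 4 (u_ 1)])
| K_1_4_1_17 : listed (kpair (iso14_1 R)
    [:: brk 2 3 (u_ 4); brk 3 4 (u_ 1)])
| K_1_4_1_21 : listed (kpair (iso14_1 R)
    [:: brk 2 3 (e_ 1); brk 3 4 (u_ 1)])
| K_1_4_1_22 : listed (kpair (iso14_1 R)
    [:: brk 2 3 (- e_ 1); brk 3 4 (u_ 1)])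
| K_2_2_1_2 (p : R) : p <> 2 -> p <> - 2 -> listed (kpair (iso22_1 R)
    [:: brk 1 2 (e_ 2); brk 1 3 (u_ 4); brk 2 3 ((p - 1) *: u_ 3);
        brk 2 4 (p *: u_ 4)])
| K_2_2_1_3 : listed (kpair (iso22_1 R)
    [:: brk 2 3 (u_ 3); brk 2 4 (u_ 4)])
| K_2_5_1_3 (r s h : R) : (s <> 0 -> 0 <= h) ->
    2 * r + h - 2^-1 * h ^+ 2 <> 0 -> listed (kpair (iso25_1 R)
    [:: brk 1 3 (u_ 1); brk 2 3 (e_ 1 + r *: e_ 2 + (1 - h) *: u_ 2);
        brk 2 4 (h *: u_ 1);
        brk 3 4 (- (r + h) *: e_ 1 + s *: e_ 2 - (1 + h) *: u_ 4)])
| K_2_5_1_4 (r h : R) : 0 <= h -> 2 * r + h - 2^-1 * h ^+ 2 <> 0 ->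
    listed (kpair (iso25_1 R)
    [:: brk 1 3 (u_ 1); brk 2 3 (r *: e_ 2 + (1 - h) *: u_ 2);
        brk 2 4 (h *: u_ 1); brk 3 4 (- (r + h) *: e_ 1 - (1 + h) *: u_ 4)])
| K_2_5_2_2 (p r s : R) : 0 <= r -> 0 <= s -> p <> - r ^+ 2 ->
    listed (kpair (iso25_2 R)
    [:: brk 1 3 (u_ 1);
        brk 2 3 ((p + s) *: e_ 1 + r *: e_ 2 + u_ 2 - (2 * r) *: u_ 4);
        brk 2 4 ((2 * r) *: u_ 1);
        brk 3 4 (- r *: e_ 1 + (p - s) *: e_ 2 - (2 * r) *: u_ 2 - u_ 4)])
| K_3_3_1_1 (p : R) : p <> 0 -> listed (kpair (iso33_1 R)
    [:: brk 1 3 (u_ 1); brk 2 3 (p *: e_ 3 + u_ 2);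
        brk 3 4 (- p *: e_ 2 - u_ 4)])
| K_3_3_2_1 (p : R) : p <> 0 -> listed (kpair (iso33_2 R)
    [:: brk 1 3 (u_ 1); brk 2 3 (p *: e_ 2 + u_ 2);
        brk 3 4 (p *: e_ 3 - u_ 4)]).

(* Main.v *)
Require Import Defs.
From HB Require Import structures.
From mathcomp Require Import all_boot all_order all_algebra reals ring lra.

Set Implicit Arguments.
Unset Strict Implicit.
Unset Printing Implicit Defensive.

Import Order.TTheory GRing.Theory Num.Theory.
Local Open Scope ring_scope.

(* Only the isotropy types 1.1^2 and 1.3^1 admit an invariant J at all: in the
   other types the isotropy operators, which commute with J, force J u_1 to be a
   multiple of u_1, against J^2 = -1.  For the two remaining types, parallelism
   of J makes the form omega(y, z) = g(J y, z) closed; closedness, the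
   Nijenhuis condition and the nondegeneracy of g contradict the brackets of
   most spaces.  For the others, holomorphy says that y |-> [X, y]_m commutes
   with J, and this forces [X, y]_m = 0 for all y.  Then L_X g = 0, and the
   soliton equation reduces to the Einstein equation, so that the Ricci tensor
   never has to be computed. *)

(** * Coordinates of m in the basis u_i, and the form g *)

Section Coordinates.
Variable R : realType.
Implicit Types (y : 'rV[R]_4) (V : lmodType R).

(* The basis of m is indexed from 1, as in [um]. *)
Definition co y (k : nat) : R := y 0 (inord k.-1).

(** Written out rather than as a big operator, so that unfolding it shows all four terms to [ring],
    [lra] and [nra]. *)
Definition sum4 (V : nmodType) (f : nat -> V) : V := f 1 + f 2 + f 3 + f 4.

Lemma coD y z k : co (y + z) k = co y k + co z k.
Proof. by rewrite /co mxE. Qed.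

Lemma coN y k : co (- y) k = - co y k.
Proof. by rewrite /co mxE. Qed.

Lemma coZ a y k : co (a *: y) k = a * co y k.
Proof. by rewrite /co mxE. Qed.

Lemma co0 k : co 0 k = 0.
Proof. by rewrite /co mxE. Qed.

(** The bound on [k] matters: outside it [inord k.-1] is the first index. *)
Lemma co_um i k : (0 < k <= 4)%N -> co (um i) k = if k == i then 1 else 0.
Proof.
case: k => // k kle; rewrite /co mxE inordK //= eq_sym.
by case: eqVneq.
Qed.

Lemma co_inj y z : (forall k, (0 < k <= 4)%N -> co y k = co z k) -> y = z.
Proof.
move=> yz; apply/rowP=> j.
by have := yz j.+1 (ltn_ord j); rewrite /co inord_val.
Qed.

Lemma sum_um y : y = sum4 (fun l => co y l *: um l).
Proof.
apply: co_inj => k kle; rewrite /sum4 !coD !coZ !co_um //.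
by case: k kle => [|[|[|[|[|k]]]]] //= _;
  rewrite ?mulr0 ?mulr1 ?addr0 ?add0r.
Qed.

(** Stated for the bare predicate [linear], since the connection, the curvature and the Ricci tensor
    are plain functions. *)
Lemma linear_sum4 V (f : 'rV[R]_4 -> V) y : linear f ->
  f y = sum4 (fun l => co y l *: f (um l)).
Proof.
move=> fl; have fZ a v : f (a *: v) = a *: f v.
  have f0 : f 0 = 0.
    by apply: (addrI (f 0)); have := fl 1 0 0; rewrite !scale1r !addr0 => <-.
  by have := fl a v 0; rewrite addr0 f0 addr0.
have fD v w : f (v + w) = f v + f w by have := fl 1 v w; rewrite !scale1r.
by rewrite {1}(sum_um y) /sum4 !fD !fZ.
Qed.

Lemma mpartD r (x y : 'rV[R]_(r + 4)) : mpart (x + y) = mpart x + mpart y.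
Proof. by rewrite /mpart linearD. Qed.

Lemma mpartN r (x : 'rV[R]_(r + 4)) : mpart (- x) = - mpart x.
Proof. by rewrite /mpart linearN. Qed.

Lemma mpartZ r a (x : 'rV[R]_(r + 4)) : mpart (a *: x) = a *: mpart x.
Proof. by rewrite /mpart linearZ. Qed.

Lemma mpart0 r : mpart (0 : 'rV[R]_(r + 4)) = 0.
Proof. by rewrite /mpart linear0. Qed.

Lemma mpart_e r i : mpart (e_ i : 'rV[R]_(r + 4)) = 0.
Proof. by rewrite /mpart /e_ /inh row_mxKr. Qed.

Lemma mpart_inm r y : mpart (inm y : 'rV[R]_(r + 4)) = y.
Proof. by rewrite /mpart /inm row_mxKr. Qed.

Lemma mpart_u r i : mpart (u_ i : 'rV[R]_(r + 4)) = um i.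
Proof. exact: mpart_inm. Qed.

Lemma inm_linear r : linear (inm : 'rV[R]_4 -> 'rV[R]_(r + 4)).
Proof. by move=> a x y; rewrite /inm scale_row_mx add_row_mx scaler0 addr0. Qed.

(** The big operator is locked; as a [foldr], the lookup in a concrete table reduces by
    computation. *)
Lemma table_val_foldr (V : nmodType) (t : seq (nat * nat * V)) i j :
  table_val t i j =
    foldr (fun x s => if (x.1.1 == i) && (x.1.2 == j) then x.2 + s else s) 0 t.
Proof. by rewrite /table_val unlock; elim: t. Qed.

Definition mpartE := (mpartD, mpartN, mpartZ, mpart0, mpart_e, mpart_u).
Definition coE := (coD, coN, coZ, co0).

Lemma gm_linearr (G : 'M[R]_4) y : linear (gm G y : 'rV[R]_4 -> R^o).
Proof.
by move=> a v w; rewrite /gm linearD linearZ /= mulmxDr -scalemxAr !mxE.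
Qed.

Lemma gm_linearl (G : 'M[R]_4) z : linear (gm G ^~ z : 'rV[R]_4 -> R^o).
Proof.
by move=> a v w; rewrite /gm !mulmxDl -!scalemxAl !mxE.
Qed.

Lemma gmDl (G : 'M[R]_4) x y z : gm G (x + y) z = gm G x z + gm G y z.
Proof. by have := gm_linearl G z 1 x y; rewrite !scale1r. Qed.
Lemma gm0l (G : 'M[R]_4) z : gm G 0 z = 0.
Proof. by rewrite /gm !mul0mx mxE. Qed.
Lemma gm0r (G : 'M[R]_4) z : gm G z 0 = 0.
Proof. by rewrite /gm trmx0 mulmx0 mxE. Qed.
Lemma gmNl (G : 'M[R]_4) y z : gm G (- y) z = - gm G y z.
Proof. by rewrite /gm !mulNmx mxE. Qed.
Lemma gmNr (G : 'M[R]_4) y z : gm G y (- z) = - gm G y z.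
Proof. by rewrite /gm linearN mulmxN mxE. Qed.

Lemma gmC (G : 'M[R]_4) y z : G^T = G -> gm G y z = gm G z y.
Proof.
move=> Gs; rewrite /gm; have -> : z *m G *m y^T = (y *m G *m z^T)^T.
  by rewrite !trmx_mul trmxK Gs mulmxA.
by rewrite [RHS]mxE.
Qed.

Lemma gm_nondeg (G : 'M[R]_4) y : G \in unitmx ->
  (forall z, gm G y z = 0) -> y = 0.
Proof.
move=> Gu y0; rewrite -[y](mulmxK Gu).
suff -> : y *m G = 0 by rewrite mul0mx.
apply/rowP=> j; have := y0 (delta_mx 0 j).
by rewrite /gm trmx_delta -colE !mxE => ->.
Qed.

End Coordinates.

(** * Linearity of connection, curvature and Ricci tensor; from solitons to Einstein metrics *)

Section Geometry.
Variables (R : realType) (r : nat).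
Variable br : {bilinear 'rV[R]_(r + 4) -> 'rV[R]_(r + 4) -> 'rV[R]_(r + 4)}.
Implicit Types (G J : 'M[R]_4) (X y z : 'rV[R]_4) (x : 'rV[R]_(r + 4)).

Lemma mbr_linearr y : linear (mbr br y).
Proof.
by move=> a v w; rewrite /mbr inm_linear linearDr linearZr mpartD mpartZ.
Qed.

Lemma mbr_linearl y : linear (mbr br ^~ y).
Proof.
by move=> a v w; rewrite /mbr inm_linear linearDl linearZl_LR mpartD mpartZ.
Qed.

Lemma isotropy_linear (x : 'rV[R]_r) : linear (isotropy br x).
Proof.
by move=> a v w; rewrite /isotropy inm_linear linearDr linearZr mpartD mpartZ.
Qed.

Lemma mulmxr_linear J : linear (fun y => y *m J).
Proof. by move=> a v w; rewrite mulmxDl scalemxAl. Qed.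

Lemma lc_vC G x1 x2 : lc_v br G x1 x2 = lc_v br G x2 x1.
Proof.
by congr (_ *m _); apply/rowP=> k; rewrite !mxE [X in _ * X]addrC.
Qed.

Lemma lc_v_linear G x : linear (lc_v br G x).
Proof.
move=> a v w; rewrite /lc_v scalemxAl -mulmxDl; congr (_ *m _).
apply/rowP=> k; rewrite !mxE linearDr linearZr !mpartD !mpartZ.
have /= -> := gm_linearr G (mpart x) a.
have /= -> := gm_linearl G (mpart (br (u_ k.+1) x)) a.
by rewrite /GRing.scale /=; ring.
Qed.

Lemma levi_civita_linearr G x : linear (levi_civita br G x).
Proof.
move=> a v w; rewrite /levi_civita inm_linear lc_v_linear linearDr linearZr.
by rewrite mpartD mpartZ !scalerDr !scalerA [2^-1 * a]mulrC addrACA.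
Qed.

Lemma levi_civita_linearl G y : linear ((levi_civita br G)^~ y).
Proof.
move=> a v w; rewrite /levi_civita ![lc_v _ _ _ (inm y)]lc_vC lc_v_linear.
rewrite linearDl linearZl_LR mpartD mpartZ !scalerDr !scalerA.
by rewrite [2^-1 * a]mulrC addrACA.
Qed.

Lemma scaler_addBB (V : lmodType R) a (v1 v2 v3 w1 w2 w3 : V) :
  a *: v1 + w1 - (a *: v2 + w2) - (a *: v3 + w3)
    = a *: (v1 - v2 - v3) + (w1 - w2 - w3).
Proof.
by rewrite !scalerBr !opprD [X in X + _ = _]addrACA [LHS]addrACA.
Qed.

(** The Ricci tensor traces over the first argument of the curvature, so its own first argument sits
    in this second slot. *)
Lemma curvature_linear_inm G x z :
  linear (fun y => curvature br G x (inm y) z).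
Proof.
move=> a v w; rewrite /curvature inm_linear linearDr linearZr.
by rewrite !levi_civita_linearl levi_civita_linearr scaler_addBB.
Qed.

Lemma curvature_linearr G x1 x2 : linear (curvature br G x1 x2).
Proof.
move=> a v w; rewrite /curvature !levi_civita_linearr.
exact: scaler_addBB.
Qed.

(** [lin1_mx] only reads off the images of the basis vectors, so a pointwise identity between
    arbitrary functions suffices. *)
Lemma lin1_mx_linear a (f g h : 'rV[R]_4 -> 'rV[R]_4) :
  (forall y, f y = a *: g y + h y) ->
  lin1_mx f = a *: lin1_mx g + lin1_mx h.
Proof. by move=> fE; apply/matrixP=> i k; rewrite !mxE fE !mxE. Qed.

Lemma ricci_linearl G z : linear ((ricci br G)^~ z : 'rV[R]_4 -> R^o).
Proof.
move=> a v w; rewrite /ricci -linearP; congr (\tr _).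
by apply: lin1_mx_linear => x; rewrite curvature_linear_inm.
Qed.

Lemma ricci_linearr G y : linear (ricci br G y : 'rV[R]_4 -> R^o).
Proof.
move=> a v w; rewrite /ricci -linearP; congr (\tr _).
by apply: lin1_mx_linear => x; rewrite curvature_linearr.
Qed.

Lemma einstein_basis G c :
  (forall i j : 'I_4, ricci br G (um i.+1) (um j.+1)
                      = c * gm G (um i.+1) (um j.+1)) ->
  einstein br G.
Proof.
move=> Rc; exists c => y z.
have Rc' i j : (0 < i <= 4)%N -> (0 < j <= 4)%N ->
    ricci br G (um i) (um j) = c * gm G (um i) (um j).
  case: i => // i ile; case: j => // j jle.
  exact: (Rc (Ordinal ile) (Ordinal jle)).
rewrite (linear_sum4 y (ricci_linearl G z)) (linear_sum4 y (gm_linearl G z)).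
rewrite /sum4 !(linear_sum4 z (ricci_linearr G _)).
rewrite !(linear_sum4 z (gm_linearr G _)) /sum4 !Rc' // /GRing.scale /=.
by ring.
Qed.

(** L_X g vanishes, and [lambda] becomes the Einstein constant. *)
Lemma soliton_einstein G X lambda : ricci_soliton br G X lambda ->
  (forall i, (0 < i <= 4)%N -> mbr br X (um i) = 0) -> einstein br G.
Proof.
move=> sol X0; apply: (@einstein_basis G lambda) => i j.
by rewrite -sol !X0 ?ltn_ord // gm0l gm0r !add0r.
Qed.

(** * The Kähler form *)

Section Kahler.
Variables G J : 'M[R]_4.
Hypothesis brL : lie_bracket br.
Hypothesis Gmet : invariant_metric br G.
Hypothesis Gkah : kahler br G J.

Let Gsym : G^T = G. Proof. by case: Gmet. Qed.
Let Gu : G \in unitmx. Proof. by case: Gmet. Qed.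
Let J2 : J *m J = - 1%:M. Proof. by case: Gkah => -[]. Qed.

(** Polarization of [br x x = 0]. *)
Lemma mbrC y z : mbr br y z = - mbr br z y.
Proof.
have brxx := brL.1; apply/eqP; rewrite -addr_eq0; apply/eqP.
have := brxx (inm (y + z)).
have -> : inm (y + z) = inm y + inm z :> 'rV_(r + 4).
  by rewrite /inm add_row_mx addr0.
rewrite linearDl !linearDr !brxx add0r addr0.
by move=> /(congr1 (@mpart R r)); rewrite mpartD mpart0.
Qed.

(** The symmetric part v cancels, and the two halves of the bracket add up. *)
Lemma levi_civita_torsion_free y z :
  levi_civita br G (inm y) z - levi_civita br G (inm z) y = mbr br y z.
Proof.
rewrite /levi_civita lc_vC -/(mbr br y z) -/(mbr br z y) (mbrC z y).
rewrite scalerN opprD opprK addrACA subrr addr0 -scalerDl.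
by rewrite (_ : 2^-1 + 2^-1 = 1) ?scale1r //; lra.
Qed.

(** Metric compatibility, read off from the Koszul formula [E]. *)
Lemma levi_civita_skew (x y z : 'rV[R]_4) :
  gm G (levi_civita br G (inm x) y) z = - gm G y (levi_civita br G (inm x) z).
Proof.
have E (a b c : 'rV[R]_4) : 2 * gm G (levi_civita br G (inm a) b) c =
    gm G (mbr br a b) c + gm G a (mbr br c b) + gm G b (mbr br c a).
  rewrite /levi_civita gmDl mulrDr two_gm_lc_v // !mpart_inm addrA.
  congr (_ + _ + _); rewrite /gm -!scalemxAl mxE mulrA divff ?mul1r //.
  by rewrite pnatr_eq0.
apply: (@mulfI _ (2 : R)); first by rewrite pnatr_eq0.
rewrite mulrN (gmC y _ Gsym) !E (mbrC x y) (mbrC x z) (mbrC z y).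
rewrite !gmNl !gmNr (gmC (mbr br y x) z Gsym) (gmC (mbr br z x) y Gsym).
by ring.
Qed.

Definition omega y z : R := gm G (y *m J) z.

(** g(Jy, z) = g(J^2 y, Jz) = - g(y, Jz). *)
Lemma omegaC y z : omega y z = - omega z y.
Proof.
case: Gkah => _ GJ _; rewrite /omega -[LHS]GJ -mulmxA J2 mulmxN mulmx1 gmNl.
by rewrite gmC.
Qed.

Lemma omega_linearl z : linear (omega ^~ z : 'rV[R]_4 -> R^o).
Proof.
by move=> a v w; rewrite /omega mulmxr_linear; exact: gm_linearl.
Qed.

(** A parallel form is closed for a torsion-free connection: each bracket becomes a difference of
    derivatives, and the six terms cancel in pairs. *)
Lemma omega_closed (x y z : 'rV[R]_4) :
  omega (mbr br x y) z + omega (mbr br y z) x + omega (mbr br z x) y = 0.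
Proof.
(* This is parallelism of [omega]: the connection commutes with J and is skew for g. *)
have E (a b c : 'rV[R]_4) : omega (levi_civita br G (inm a) b) c =
    omega (levi_civita br G (inm a) c) b.
  rewrite -[RHS]opprK -(omegaC _ (levi_civita _ _ _ _)) /omega.
  by case: Gkah => _ _ <-; rewrite levi_civita_skew.
have B (a b c : 'rV[R]_4) : omega (a - b) c = omega a c - omega b c.
  by rewrite /omega mulmxBl gmDl gmNl.
rewrite -!levi_civita_torsion_free !B (E x y) (E y x) (E z y).
by ring.
Qed.

(** * The Kähler conditions as scalar equations in J, g and the structure constants *)

Lemma co_linear (f : 'rV[R]_4 -> 'rV[R]_4) y k : linear f ->
  co (f y) k = sum4 (fun l => co y l * co (f (um l)) k).
Proof. by move=> fl; rewrite (linear_sum4 y fl) /sum4 !coD !coZ. Qed.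

Local Notation j i k := (co (um i%N *m J) k%N).
Local Notation b i l k := (co (mbr br (um i%N) (um l%N)) k%N).
Local Notation g i k := (gm G (um i%N) (um k%N)).
(** The value omega(u_i, u_k), expanded in the entries of J and g. *)
Local Notation w i k := (sum4 (fun l => j i l * g l k)).

Lemma co_mulmxJ y k : co (y *m J) k = sum4 (fun l => co y l * j l k).
Proof. exact: co_linear (mulmxr_linear J). Qed.

Lemma co_mbr y z k :
  co (mbr br y z) k = sum4 (fun l => sum4 (fun m => co y l * co z m * b l m k)).
Proof.
rewrite (co_linear y k (mbr_linearl z)) /sum4.
by rewrite !(co_linear z k (mbr_linearr _)) /sum4; ring.
Qed.

Lemma omegaE y k : omega y (um k) = sum4 (fun l => co y l * w l k).
Proof.
rewrite (linear_sum4 y (omega_linearl (um k))).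
have wE l : omega (um l) (um k) = w l k.
  by rewrite /omega (linear_sum4 (um l *m J) (gm_linearl G (um k))).
by rewrite /sum4 /= !wE.
Qed.

Lemma sqrJ_coord i k : (0 < i <= 4)%N -> (0 < k <= 4)%N ->
  sum4 (fun l => j i l * j l k) = if k == i then -1 else 0.
Proof.
move=> ile kle; rewrite -co_mulmxJ -mulmxA J2 mulmxN mulmx1 coN co_um //.
by case: eqP; rewrite ?oppr0.
Qed.

Lemma isotropyJ_coord (x : 'rV[R]_r) i k :
  sum4 (fun l => j i l * co (isotropy br x (um l)) k)
  = sum4 (fun l => co (isotropy br x (um i)) l * j l k).
Proof.
rewrite -co_mulmxJ -(co_linear _ _ (isotropy_linear x)).
by case: Gkah => -[_ -> _].
Qed.

Lemma omegaC_coord i k : (0 < i <= 4)%N -> (0 < k <= 4)%N -> w i k = - w k i.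
Proof.
move=> ile kle; have E l m : (0 < l <= 4)%N -> omega (um l) (um m) = w l m.
  by move=> lle; rewrite /omega (linear_sum4 (um l *m J) (gm_linearl G (um m))).
by rewrite -!E // omegaC.
Qed.

Lemma omega_closed_coord i1 i2 i3 :
  sum4 (fun l => b i1 i2 l * w l i3) + sum4 (fun l => b i2 i3 l * w l i1)
    + sum4 (fun l => b i3 i1 l * w l i2) = 0.
Proof. by rewrite -!omegaE omega_closed. Qed.

Lemma nijenhuis_coord i1 i2 k :
  sum4 (fun l => sum4 (fun m => j i1 l * j i2 m * b l m k))
    - sum4 (fun l => sum4 (fun m => j i2 m * b i1 m l) * j l k)
    - sum4 (fun l => sum4 (fun m => j i1 m * b m i2 l) * j l k)
    - b i1 i2 k = 0.
Proof.
have [[_ _ N] _ _] := Gkah.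
have := congr1 ((@co R)^~ k) (N (um i1) (um i2)); rewrite !coD !coN co0 => <-.
rewrite -co_mbr; congr (_ - _ - _ - _).
  rewrite co_mulmxJ; congr (_ + _ + _ + _);
    by rewrite (co_linear _ _ (mbr_linearr _)).
rewrite co_mulmxJ; congr (_ + _ + _ + _);
  by rewrite (co_linear _ _ (mbr_linearl _)).
Qed.

Lemma gmC_coord i k : g i k = g k i.
Proof. exact: gmC. Qed.

Lemma isotropy_gm_coord (x : 'rV[R]_r) i k :
  sum4 (fun l => co (isotropy br x (um i)) l * g l k)
    + sum4 (fun l => co (isotropy br x (um k)) l * g l i) = 0.
Proof.
have [_ _ inv] := Gmet; rewrite -(inv x (um i) (um k)).
rewrite (linear_sum4 (isotropy br x (um i)) (gm_linearl _ _)); congr (_ + _).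
rewrite (gmC (um i) _ Gsym).
by rewrite (linear_sum4 (isotropy br x (um k)) (gm_linearl _ _)).
Qed.

Lemma gm_nondeg_coord i : (0 < i <= 4)%N ->
  gm G (um i) (um 1) = 0 -> gm G (um i) (um 2) = 0 ->
  gm G (um i) (um 3) = 0 -> gm G (um i) (um 4) = 0 -> False.
Proof.
move=> ile g1 g2 g3 g4.
suff /(congr1 ((@co R)^~ i)) : um i = 0 :> 'rV[R]_4.
  by rewrite co_um // eqxx co0 => /eqP; rewrite oner_eq0.
apply: (gm_nondeg Gu) => z; rewrite (linear_sum4 z (gm_linearr _ _)) /sum4.
by rewrite g1 g2 g3 g4 !scaler0 !addr0.
Qed.

Lemma holomorphic_coord X i k : holomorphic br X J ->
  sum4 (fun l => j i l * sum4 (fun m => co X m * b m l k))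
  = sum4 (fun l => sum4 (fun m => co X m * b m i l) * j l k).
Proof.
move=> hol; have E m l : co (mbr br X (um m)) l
    = sum4 (fun n => co X n * b n m l).
  exact: co_linear (mbr_linearl _).
rewrite /sum4 in E *; rewrite -!E; have := congr1 ((@co R)^~ k) (hol (um i)).
by rewrite co_mulmxJ (co_linear _ _ (mbr_linearr X)).
Qed.

End Kahler.

Lemma mbr_sum4 X y : mbr br X y = sum4 (fun l => co X l *: mbr br (um l) y).
Proof. exact: linear_sum4 (mbr_linearl y). Qed.

Lemma soliton0_einstein G X lambda : ricci_soliton br G X lambda ->
  co X 1 = 0 -> co X 2 = 0 -> co X 3 = 0 -> co X 4 = 0 -> einstein br G.
Proof.
move=> sol x1 x2 x3 x4; apply: (soliton_einstein sol) => i _.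
by rewrite mbr_sum4 /sum4 x1 x2 x3 x4 !scale0r !addr0.
Qed.

End Geometry.

(** * Reading the isotropy action and the brackets off the tables *)

Section Realizations.
Variables (R : realType) (r : nat) (iso tab : seq (nat * nat * 'rV[R]_(r + 4))).
Variables (cond : 'M[R]_4 -> Prop).
Variable br : {bilinear 'rV[R]_(r + 4) -> 'rV[R]_(r + 4) -> 'rV[R]_(r + 4)}.
Hypothesis Pbr : realizes (KomrakovPair iso tab cond) br.

Lemma isotropy_um i k : (0 < i <= r)%N -> (0 < k <= 4)%N ->
  isotropy br (eh i) (um k) = mpart (table_val iso i k).
Proof.
case: i k => [|i] [|k] //= ile kle; have [_ _ + _] := Pbr.
exact: (fun H => H (Ordinal ile) (Ordinal kle)).
Qed.

Lemma mbr_um i k : (0 < i <= 4)%N -> (0 < k <= 4)%N ->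
  mbr br (um i) (um k) = mpart (table_val tab i k) - mpart (table_val tab k i).
Proof.
case: i k => [|i] [|k] //= ile kle; have [_ _ _ H] := Pbr.
by rewrite /mbr -mpartN -mpartD -(H (Ordinal ile) (Ordinal kle)).
Qed.

End Realizations.

Section NoInvariantComplexStructure.
Variables (R : realType) (r : nat).
Variable br : {bilinear 'rV[R]_(r + 4) -> 'rV[R]_(r + 4) -> 'rV[R]_(r + 4)}.
Variables G J : 'M[R]_4.
Hypothesis kah : kahler br G J.

(** The (1, 1) entry of J^2 = -1 would read j_11^2 = -1 over the reals. *)
Lemma um1_not_eigenvector : co (um 1 *m J) 2 = 0 -> co (um 1 *m J) 3 = 0 ->
  co (um 1 *m J) 4 = 0 -> False.
Proof.
move=> j12 j13 j14; have := sqrJ_coord kah (i := 1) (k := 1) isT isT.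
by rewrite /sum4 j12 j13 j14 /=; nra.
Qed.

End NoInvariantComplexStructure.

Ltac isotropy_entries Pbr :=
  rewrite /sum4 !(isotropy_um Pbr) // !table_val_foldr /= !mpartE !coE
    !co_um //=.

Ltac bracket_entries Pbr :=
  rewrite ?/sum4 !(mbr_um Pbr) // !table_val_foldr /= !mpartE ?coE ?co_um //=.

(** The known zero entries of J are used first: they remove most terms of the sums before any
    bracket is looked up. *)
Ltac sparse_bracket_entries Pbr Jr :=
  rewrite /sum4 ?Jr ?(mul0r, mulr0, add0r, addr0); bracket_entries Pbr.

(** * Isotropy types in which J preserves the line of u_1 *)

Section RankOneTypes.
Variables (R : realType) (G J : 'M[R]_4) (cond : 'M[R]_4 -> Prop).

(** u_1 spans the eigenspace of e_1 for the eigenvalue 1. *)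
Lemma not_kahler_11_1 tab
    (br : {bilinear 'rV[R]_(1 + 4) -> 'rV[R]_(1 + 4) -> 'rV[R]_(1 + 4)}) :
  realizes (KomrakovPair (iso11_1 R) tab cond) br -> ~ kahler br G J.
Proof.
move=> Pbr kah.
have := isotropyJ_coord kah (eh 1) 1 2; isotropy_entries Pbr => ?.
have := isotropyJ_coord kah (eh 1) 1 3; isotropy_entries Pbr => ?.
have := isotropyJ_coord kah (eh 1) 1 4; isotropy_entries Pbr => ?.
by apply: (um1_not_eigenvector kah); lra.
Qed.

(** e_1 sends u_3 to u_2 and u_2 to u_1, and kills u_1 and u_4, so u_1 spans the image of its
    square. *)
Lemma not_kahler_14_1 tab
    (br : {bilinear 'rV[R]_(1 + 4) -> 'rV[R]_(1 + 4) -> 'rV[R]_(1 + 4)}) :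
  realizes (KomrakovPair (iso14_1 R) tab cond) br -> ~ kahler br G J.
Proof.
move=> Pbr kah.
have := isotropyJ_coord kah (eh 1) 2 2; isotropy_entries Pbr => ?.
have := isotropyJ_coord kah (eh 1) 2 3; isotropy_entries Pbr => ?.
have := isotropyJ_coord kah (eh 1) 2 4; isotropy_entries Pbr => ?.
have := isotropyJ_coord kah (eh 1) 3 3; isotropy_entries Pbr => ?.
by apply: (um1_not_eigenvector kah); lra.
Qed.

(** Again u_1 spans an eigenspace of e_1. *)
Lemma not_kahler_22_1 tab
    (br : {bilinear 'rV[R]_(2 + 4) -> 'rV[R]_(2 + 4) -> 'rV[R]_(2 + 4)}) :
  realizes (KomrakovPair (iso22_1 R) tab cond) br -> ~ kahler br G J.
Proof.
move=> Pbr kah.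
have := isotropyJ_coord kah (eh 1) 1 2; isotropy_entries Pbr => ?.
have := isotropyJ_coord kah (eh 1) 1 3; isotropy_entries Pbr => ?.
have := isotropyJ_coord kah (eh 1) 1 4; isotropy_entries Pbr => ?.
by apply: (um1_not_eigenvector kah); lra.
Qed.

(** The images of e_1 and e_2 are spanned by u_1, u_4 and by u_1, u_2; they meet in the line of
    u_1. *)
Lemma not_kahler_25_1 tab
    (br : {bilinear 'rV[R]_(2 + 4) -> 'rV[R]_(2 + 4) -> 'rV[R]_(2 + 4)}) :
  realizes (KomrakovPair (iso25_1 R) tab cond) br -> ~ kahler br G J.
Proof.
move=> Pbr kah.
have := isotropyJ_coord kah (eh 1) 2 2; isotropy_entries Pbr => ?.
have := isotropyJ_coord kah (eh 1) 2 3; isotropy_entries Pbr => ?.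
have := isotropyJ_coord kah (eh 2) 4 4; isotropy_entries Pbr => ?.
by apply: (um1_not_eigenvector kah); lra.
Qed.

(** u_1 spans the image of the square of e_1. *)
Lemma not_kahler_25_2 tab
    (br : {bilinear 'rV[R]_(2 + 4) -> 'rV[R]_(2 + 4) -> 'rV[R]_(2 + 4)}) :
  realizes (KomrakovPair (iso25_2 R) tab cond) br -> ~ kahler br G J.
Proof.
move=> Pbr kah.
have := isotropyJ_coord kah (eh 1) 2 2; isotropy_entries Pbr => ?.
have := isotropyJ_coord kah (eh 1) 2 3; isotropy_entries Pbr => ?.
have := isotropyJ_coord kah (eh 1) 2 4; isotropy_entries Pbr => ?.
have := isotropyJ_coord kah (eh 1) 3 3; isotropy_entries Pbr => ?.
by apply: (um1_not_eigenvector kah); lra.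
Qed.

(** The images of e_2 and e_3 meet in the line of u_1. *)
Lemma not_kahler_33_1 tab
    (br : {bilinear 'rV[R]_(3 + 4) -> 'rV[R]_(3 + 4) -> 'rV[R]_(3 + 4)}) :
  realizes (KomrakovPair (iso33_1 R) tab cond) br -> ~ kahler br G J.
Proof.
move=> Pbr kah.
have := isotropyJ_coord kah (eh 2) 2 2; isotropy_entries Pbr => ?.
have := isotropyJ_coord kah (eh 2) 2 3; isotropy_entries Pbr => ?.
have := isotropyJ_coord kah (eh 3) 4 4; isotropy_entries Pbr => ?.
by apply: (um1_not_eigenvector kah); lra.
Qed.

(** u_1 spans the image of the square of e_2. *)
Lemma not_kahler_33_2 tab
    (br : {bilinear 'rV[R]_(3 + 4) -> 'rV[R]_(3 + 4) -> 'rV[R]_(3 + 4)}) :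
  realizes (KomrakovPair (iso33_2 R) tab cond) br -> ~ kahler br G J.
Proof.
move=> Pbr kah.
have := isotropyJ_coord kah (eh 2) 2 2; isotropy_entries Pbr => ?.
have := isotropyJ_coord kah (eh 2) 2 3; isotropy_entries Pbr => ?.
have := isotropyJ_coord kah (eh 2) 2 4; isotropy_entries Pbr => ?.
have := isotropyJ_coord kah (eh 2) 3 3; isotropy_entries Pbr => ?.
by apply: (um1_not_eigenvector kah); lra.
Qed.

End RankOneTypes.

(** * Isotropy type 1.3^1: shapes of J and g, and closedness *)

Section Shape13_1.
Variables (R : realType) (tab : seq (nat * nat * 'rV[R]_(1 + 4))).
Variables (cond : 'M[R]_4 -> Prop) (G J : 'M[R]_4).
Variable br : {bilinear 'rV[R]_(1 + 4) -> 'rV[R]_(1 + 4) -> 'rV[R]_(1 + 4)}.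
Hypothesis Pbr : realizes (KomrakovPair (iso13_1 R) tab cond) br.
Hypothesis Gmet : invariant_metric br G.
Hypothesis kah : kahler br G J.

Local Notation j i k := (co (um i%N *m J) k%N).
Local Notation g i k := (gm G (um i%N) (um k%N)).

(** The kernel and the image of e_1 are both the span of u_1 and u_2. J preserves it and, commuting
    with e_1, has the same 2 x 2 block on the quotient. This block squares to -1, so it is traceless
    with nonzero off-diagonal entries. *)
Lemma J_shape_13_1 :
  [/\ [/\ j 1 3 = 0, j 1 4 = 0, j 2 3 = 0 & j 2 4 = 0],
      [/\ j 2 2 = - j 1 1, j 3 3 = j 1 1, j 3 4 = j 1 2, j 4 3 = j 2 1
        & j 4 4 = - j 1 1],
      j 1 1 ^+ 2 + j 1 2 * j 2 1 = -1 & j 1 2 != 0 /\ j 2 1 != 0].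
Proof.
have := isotropyJ_coord kah (eh 1) 3 1; isotropy_entries Pbr => ?.
have := isotropyJ_coord kah (eh 1) 3 2; isotropy_entries Pbr => ?.
have := isotropyJ_coord kah (eh 1) 3 3; isotropy_entries Pbr => ?.
have := isotropyJ_coord kah (eh 1) 3 4; isotropy_entries Pbr => ?.
have := isotropyJ_coord kah (eh 1) 4 1; isotropy_entries Pbr => ?.
have := isotropyJ_coord kah (eh 1) 4 2; isotropy_entries Pbr => ?.
have := isotropyJ_coord kah (eh 1) 4 3; isotropy_entries Pbr => ?.
have := isotropyJ_coord kah (eh 1) 4 4; isotropy_entries Pbr => ?.
have j13 : j 1 3 = 0 by lra.
have j14 : j 1 4 = 0 by lra.
have j23 : j 2 3 = 0 by lra.
have j24 : j 2 4 = 0 by lra.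
have := sqrJ_coord kah (i := 1) (k := 1) isT isT.
have := sqrJ_coord kah (i := 1) (k := 2) isT isT.
rewrite /sum4 j13 j14 !mul0r !addr0 /= => S12 S11.
have jn : j 1 2 * j 2 1 != 0 by apply/eqP=> j0; nra.
move: (jn); rewrite mulf_eq0 negb_or => /andP[j12n j21n].
have j22 : j 2 2 = - j 1 1 by apply: (mulfI j12n); lra.
by split=> //; split=> //; lra.
Qed.

(** Skewness of e_1 makes the span of u_1 and u_2 totally isotropic; nondegeneracy then gives g(u_1,
    u_4) != 0. The entries of g on u_3 and u_4 stay free. *)
Lemma g_shape_13_1 :
  [/\ [/\ g 1 1 = 0, g 1 2 = 0, g 1 3 = 0, g 2 1 = 0 & g 2 2 = 0],
      [/\ g 2 3 = - g 1 4, g 2 4 = 0, g 3 1 = 0, g 3 2 = - g 1 4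
        & g 4 2 = 0],
      g 4 1 = g 1 4 & g 1 4 != 0].
Proof.
have := isotropy_gm_coord Gmet (eh 1) 3 3; isotropy_entries Pbr => ?.
have := isotropy_gm_coord Gmet (eh 1) 4 4; isotropy_entries Pbr => ?.
have := isotropy_gm_coord Gmet (eh 1) 3 4; isotropy_entries Pbr => ?.
have := isotropy_gm_coord Gmet (eh 1) 3 1; isotropy_entries Pbr => ?.
have := isotropy_gm_coord Gmet (eh 1) 3 2; isotropy_entries Pbr => ?.
have := isotropy_gm_coord Gmet (eh 1) 4 2; isotropy_entries Pbr => ?.
have [g21 g31 g41] := And3 (gmC_coord Gmet 2 1) (gmC_coord Gmet 3 1)
  (gmC_coord Gmet 4 1).
have [g32 g42] := conj (gmC_coord Gmet 3 2) (gmC_coord Gmet 4 2).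
have g14 : g 1 4 != 0.
  by apply/eqP=> g0; apply: (gm_nondeg_coord Gmet (i := 1) isT) => //; lra.
by split=> //; split=> //; lra.
Qed.

Local Notation b i k l := (co (mbr br (um i%N) (um k%N)) l%N).

Let brL : lie_bracket br. Proof. by case: Pbr. Qed.

(* d omega(u_1, u_3, u_4) = 0 divided by g(u_1, u_4), where
   c = omega(u_3, u_4) / g(u_1, u_4). *)
Lemma omega_closed_134 : exists c,
  j 1 1 * (b 1 3 1 - b 1 4 2 - b 3 4 4) + j 2 1 * b 1 3 2
    + j 1 2 * (b 3 4 3 + b 1 4 1) + c * (b 1 3 3 + b 1 4 4) = 0.
Proof.
have [[j13 j14 j23 j24] [j22 j33 j34 j43 j44] _ _] := J_shape_13_1.
have [[g11 g12 g13 g21 g22] [g23 g24 g31 g32 g42] g41 g14] := g_shape_13_1.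
have Jr := (j13, j14, j23, j24, j22, j33, j34, j43, j44).
have Gr := (g11, g12, g13, g21, g22, g23, g24, g31, g32, g42, g41).
(* The free entries of J and g enter only through this quotient. Its coefficient is 0 for the tables
   treated below by this lemma, where [u_1, u_3] and [u_1, u_4] have no u_3 or u_4 component. *)
exists (sum4 (fun l => j 3 l * g l 4) / g 1 4).
have := divfK g14 (sum4 (fun l => j 3 l * g l 4)).
move: (_ / _) => c; have := omega_closed_coord brL Gmet kah 1 3 4.
have := omegaC_coord Gmet kah (i := 3) (k := 4) isT isT.
have := omegaC_coord Gmet kah (i := 4) (k := 4) isT isT.
have := omegaC_coord Gmet kah (i := 3) (k := 3) isT isT.
rewrite (mbrC brL (um 4)) /sum4 !coN ?Jr ?Gr => w33 w44 w34 C cE.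
(* [lra] does not multiply hypotheses, so each relation is multiplied in advance by its structure
   constant. *)
have := congr1 ( *%R (b 1 3 3 + b 1 4 4)) cE.
have := congr1 ( *%R (b 1 4 4)) w34; have := congr1 ( *%R (b 1 3 4)) w44.
have := congr1 ( *%R (b 1 4 3)) w33.
by move=> ? ? ? ?; apply: (mulfI g14); lra.
Qed.

(** Closedness at (u_2, u_3, u_4), with the same quotient c. *)
Lemma omega_closed_234 : exists c,
  j 1 1 * (b 2 3 1 - b 2 4 2 - b 3 4 3) + j 2 1 * (b 2 3 2 - b 3 4 4)
    + j 1 2 * b 2 4 1 + c * (b 2 3 3 + b 2 4 4) = 0.
Proof.
have [[j13 j14 j23 j24] [j22 j33 j34 j43 j44] _ _] := J_shape_13_1.
have [[g11 g12 g13 g21 g22] [g23 g24 g31 g32 g42] g41 g14] := g_shape_13_1.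
have Jr := (j13, j14, j23, j24, j22, j33, j34, j43, j44).
have Gr := (g11, g12, g13, g21, g22, g23, g24, g31, g32, g42, g41).
exists (sum4 (fun l => j 3 l * g l 4) / g 1 4).
have := divfK g14 (sum4 (fun l => j 3 l * g l 4)).
move: (_ / _) => c; have := omega_closed_coord brL Gmet kah 2 3 4.
have := omegaC_coord Gmet kah (i := 3) (k := 4) isT isT.
have := omegaC_coord Gmet kah (i := 4) (k := 4) isT isT.
have := omegaC_coord Gmet kah (i := 3) (k := 3) isT isT.
rewrite (mbrC brL (um 4)) /sum4 !coN ?Jr ?Gr => w33 w44 w34 C cE.
have := congr1 ( *%R (b 2 3 3 + b 2 4 4)) cE.
have := congr1 ( *%R (b 2 4 4)) w34; have := congr1 ( *%R (b 2 3 4)) w44.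
have := congr1 ( *%R (b 2 4 3)) w33.
by move=> ? ? ? ?; apply: (mulfI g14); lra.
Qed.

End Shape13_1.

(** * Isotropy type 1.1^2: shapes of J and g, and closedness *)

Section Shape11_2.
Variables (R : realType) (tab : seq (nat * nat * 'rV[R]_(1 + 4))).
Variables (cond : 'M[R]_4 -> Prop) (G J : 'M[R]_4).
Variable br : {bilinear 'rV[R]_(1 + 4) -> 'rV[R]_(1 + 4) -> 'rV[R]_(1 + 4)}.
Hypothesis Pbr : realizes (KomrakovPair (iso11_2 R) tab cond) br.
Hypothesis Gmet : invariant_metric br G.
Hypothesis kah : kahler br G J.

Local Notation j i k := (co (um i%N *m J) k%N).
Local Notation g i k := (gm G (um i%N) (um k%N)).

(** e_1 rotates the plane of u_1, u_3 and kills u_2, u_4, so J preserves both planes. On the first,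
    J commutes with a rotation and squares to -1, hence has no scalar part; on the second, j_24 = 0
    would give j_22^2 = -1. *)
Lemma J_shape_11_2 :
  [/\ [/\ j 1 1 = 0, j 1 2 = 0, j 1 4 = 0 & j 1 3 != 0],
      [/\ j 2 1 = 0, j 2 3 = 0 & j 2 4 != 0]
    & [/\ j 3 1 = - j 1 3, j 3 2 = 0, j 3 3 = 0 & j 3 4 = 0]].
Proof.
have := isotropyJ_coord kah (eh 1) 1 1; isotropy_entries Pbr => ?.
have := isotropyJ_coord kah (eh 1) 1 2; isotropy_entries Pbr => ?.
have := isotropyJ_coord kah (eh 1) 1 3; isotropy_entries Pbr => ?.
have := isotropyJ_coord kah (eh 1) 1 4; isotropy_entries Pbr => ?.
have := isotropyJ_coord kah (eh 1) 2 1; isotropy_entries Pbr => ?.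
have := isotropyJ_coord kah (eh 1) 2 3; isotropy_entries Pbr => ?.
have := isotropyJ_coord kah (eh 1) 3 2; isotropy_entries Pbr => ?.
have := isotropyJ_coord kah (eh 1) 3 4; isotropy_entries Pbr => ?.
have j12 : j 1 2 = 0 by lra.
have j14 : j 1 4 = 0 by lra.
have j21 : j 2 1 = 0 by lra.
have j23 : j 2 3 = 0 by lra.
have j31 : j 3 1 = - j 1 3 by lra.
have j33 : j 3 3 = j 1 1 by lra.
have := sqrJ_coord kah (i := 1) (k := 1) isT isT.
have := sqrJ_coord kah (i := 1) (k := 3) isT isT.
have := sqrJ_coord kah (i := 2) (k := 2) isT isT.
rewrite /sum4 j12 j14 j21 j23 j31 j33 /= => S22 S13 S11.
have j13 : j 1 3 != 0 by apply/eqP=> j0; nra.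
have j24 : j 2 4 != 0 by apply/eqP=> j0; nra.
have j11 : j 1 1 = 0 by apply: (mulfI j13); lra.
by split; split=> //; lra.
Qed.

(** Invariance under the rotation makes g a multiple of the Euclidean form on the plane of u_1, u_3,
    orthogonal to u_2 and u_4; nondegeneracy makes the multiple nonzero. *)
Lemma g_shape_11_2 :
  [/\ g 1 3 = 0, g 3 1 = 0, g 3 3 = g 1 1 & g 1 1 != 0].
Proof.
have := isotropy_gm_coord Gmet (eh 1) 1 1; isotropy_entries Pbr => ?.
have := isotropy_gm_coord Gmet (eh 1) 1 3; isotropy_entries Pbr => ?.
have := isotropy_gm_coord Gmet (eh 1) 3 2; isotropy_entries Pbr => ?.
have := isotropy_gm_coord Gmet (eh 1) 3 4; isotropy_entries Pbr => ?.
have [g21 g31 g41] := And3 (gmC_coord Gmet 2 1) (gmC_coord Gmet 3 1)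
  (gmC_coord Gmet 4 1).
have g11 : g 1 1 != 0.
  by apply/eqP=> g0; apply: (gm_nondeg_coord Gmet (i := 1) isT) => //; lra.
by split=> //; lra.
Qed.

(** Closedness at (u_1, u_3, u_4) becomes 2 omega(u_1, u_3) = 0, whereas omega(u_1, u_3) = j_13
    g_11. This excludes 1.1^2.2. *)
Lemma not_homothety_11_2 : mbr br (um 1) (um 3) = 0 ->
  mbr br (um 1) (um 4) = um 1 -> mbr br (um 3) (um 4) = um 3 -> False.
Proof.
have brL : lie_bracket br by case: Pbr.
have [[j11 j12 j14 j13] _ _] := J_shape_11_2.
have [g13 _ g33 g11] := g_shape_11_2.
have := omega_closed brL Gmet kah (um 1) (um 3) (um 4).
rewrite (mbrC brL (um 4)) => + b13 b14 b34; rewrite b13 b14 b34.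
rewrite {1 3}/omega mul0mx mulNmx gm0l gmNl -/(omega _ _ _ _).
rewrite -/(omega G J (um 1) (um 3)) (omegaC Gmet kah (um 3)).
have -> : omega G J (um 1) (um 3) = j 1 3 * g 1 1.
  rewrite /omega (linear_sum4 (um 1 *m J) (gm_linearl G _)) /sum4.
  by rewrite j11 j12 j14 !scale0r !add0r addr0 g33.
by have := mulf_neq0 j13 g11; move=> /eqP jg C; apply: jg; lra.
Qed.

End Shape11_2.

(** * Spaces of type 1.3^1 excluded by the Nijenhuis condition *)

Section KahlerCases.
Variables (R : realType) (G J : 'M[R]_4).
Variable br : {bilinear 'rV[R]_(1 + 4) -> 'rV[R]_(1 + 4) -> 'rV[R]_(1 + 4)}.
Hypothesis Gmet : invariant_metric br G.
Hypothesis kah : kahler br G J.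

(** The u_1-coordinate of the Nijenhuis tensor at (u_1, u_3) is - (j_11^2 + 1). *)
Lemma not_kahler_1_3_1_2 : ~ realizes (kpair (iso13_1 R)
    [:: brk 1 3 (u_ 1); brk 2 4 (u_ 2)]) br.
Proof.
move=> Pbr.
have [[j13 j14 j23 j24] [j22 j33 j34 j43 j44] Jsq _] := J_shape_13_1 Pbr kah.
have Jr := (j13, j14, j23, j24, j22, j33, j34, j43, j44).
have := nijenhuis_coord kah 1 3 1; sparse_bracket_entries Pbr Jr; nra.
Qed.

(** The bracket [u_3, u_4] = e_1 has no component in m, so the Nijenhuis tensor is that of
    1.3^1.2. *)
Lemma not_kahler_1_3_1_3 : ~ realizes (kpair (iso13_1 R)
    [:: brk 1 3 (u_ 1); brk 2 4 (u_ 2); brk 3 4 (e_ 1)]) br.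
Proof.
move=> Pbr.
have [[j13 j14 j23 j24] [j22 j33 j34 j43 j44] Jsq _] := J_shape_13_1 Pbr kah.
have Jr := (j13, j14, j23, j24, j22, j33, j34, j43, j44).
have := nijenhuis_coord kah 1 3 1; sparse_bracket_entries Pbr Jr; nra.
Qed.

(** Closedness reads (p + 1) j_12 = 0; for p = -1 the u_2-coordinate of the Nijenhuis tensor at
    (u_1, u_3) is - 2 j_12^2. *)
Lemma not_kahler_1_3_1_14 p : ~ realizes (kpair (iso13_1 R)
    [:: brk 1 4 (u_ 1); brk 2 3 ((1 - p) *: u_ 1);
        brk 2 4 ((p * (p - 1)) *: e_ 1 + u_ 2);
        brk 3 4 (e_ 1 + p *: u_ 3)]) br.
Proof.
move=> Pbr.
have [[j13 j14 j23 j24] [j22 j33 j34 j43 j44] _ [j12 _]] :=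
  J_shape_13_1 Pbr kah.
have Jr := (j13, j14, j23, j24, j22, j33, j34, j43, j44).
have [c] := omega_closed_134 Pbr Gmet kah; bracket_entries Pbr => c134.
have pN1 : p = -1 by apply: (mulfI j12); lra.
have := nijenhuis_coord kah 1 3 2; sparse_bracket_entries Pbr Jr.
rewrite ?pN1 => N132.
by move/eqP: (mulf_neq0 j12 j12); apply; lra.
Qed.

End KahlerCases.

(** * Spaces where holomorphy of X makes the soliton Einstein *)

Section SolitonCases.
Variables (R : realType) (G J : 'M[R]_4) (X : 'rV[R]_4) (lambda : R).
Variable br : {bilinear 'rV[R]_(1 + 4) -> 'rV[R]_(1 + 4) -> 'rV[R]_(1 + 4)}.
Hypothesis Gmet : invariant_metric br G.
Hypothesis notE : ~ einstein br G.
Hypothesis sol : ricci_soliton br G X lambda.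
Hypothesis kah : kahler br G J.
Hypothesis hol : holomorphic br X J.

(** J u_2 has only the components j_22 and j_24 != 0 along u_2 and u_4, so the four coordinates of
    [X, J u_2]_m = J [X, u_2]_m give X = 0. *)
Lemma not_soliton_1_1_2_1 : ~ realizes (kpair (iso11_2 R)
  [:: brk 1 3 (- u_ 2); brk 1 4 (u_ 1); brk 2 4 (2 *: u_ 2);
      brk 3 4 (u_ 3)]) br.
Proof.
move=> Pbr.
have [[j11 j12 j14 _] [j21 j23 j24] [j31 j32 j33 j34]] := J_shape_11_2 Pbr kah.
have Jr := (j11, j12, j14, j21, j23, j31, j32, j33, j34).
have := holomorphic_coord 2 1 hol; sparse_bracket_entries Pbr Jr => h21.
have x1 : co X 1 = 0 by apply: (mulfI j24); lra.
have := holomorphic_coord 2 3 hol; sparse_bracket_entries Pbr Jr => h23.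
have x3 : co X 3 = 0 by apply: (mulfI j24); lra.
have := holomorphic_coord 2 4 hol; sparse_bracket_entries Pbr Jr => h24.
have x4 : co X 4 = 0 by apply: (mulfI j24); lra.
have := holomorphic_coord 2 2 hol; sparse_bracket_entries Pbr Jr.
rewrite ?x4 => h22.
have x2 : co X 2 = 0 by apply: (mulfI j24); lra.
exact: notE (soliton0_einstein sol x1 x2 x3 x4).
Qed.

(* Covers 1.1^2.6 and 1.1^2.7: [v] is e_1 or - e_1. *)
Lemma not_soliton_1_1_2_6 v : mpart v = 0 ->
  ~ realizes (kpair (iso11_2 R) [:: brk 1 3 v; brk 2 4 (u_ 2)]) br.
Proof.
move=> v0 Pbr.
have [_ [j21 j23 j24] _] := J_shape_11_2 Pbr kah.
have := holomorphic_coord 2 4 hol; bracket_entries Pbr.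
rewrite ?v0 ?co0 ?j21 ?j23 => h24.
have x4 : co X 4 = 0 by apply: (mulfI j24); lra.
have := holomorphic_coord 2 2 hol; bracket_entries Pbr.
rewrite ?v0 ?co0 ?j21 ?j23 x4 => h22.
have x2 : co X 2 = 0 by apply: (mulfI j24); lra.
(* X may keep components along u_1 and u_3, but these have zero m-bracket with every u_i. *)
apply/notE/(soliton_einstein sol) => i ile.
rewrite mbr_sum4 /sum4 x2 x4 !scale0r !addr0.
by case: i ile => [|[|[|[|[|i]]]]] // _; rewrite !(mbr_um Pbr) //
  !table_val_foldr /= ?mpartE ?v0 ?addr0 ?subr0 ?oppr0 ?scaler0 ?addr0.
Qed.

(* Covers both forms of 1.3^1.1: [v] is u_1 or u_3. *)
Lemma not_soliton_1_3_1_1 v : co (mpart v) 4 = 0 -> co (mpart v) 3 != 2^-1 ->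
  ~ realizes (kpair (iso13_1 R)
    [:: brk 1 2 (- 2^-1 *: u_ 2); brk 1 3 v; brk 1 4 (2^-1 *: u_ 4);
        brk 2 3 (2^-1 *: u_ 4)]) br.
Proof.
rewrite -subr_eq0 => v4 v3 Pbr.
have [[j13 j14 j23 j24] [j22 j33 j34 j43 j44] _ [_ j21]] :=
  J_shape_13_1 Pbr kah.
have Jr := (j13, j14, j23, j24, j22, j33, j34, j43, j44).
have := holomorphic_coord 1 3 hol; sparse_bracket_entries Pbr Jr.
rewrite ?v4 => h13.
have x4 : co X 4 = 0 by apply: (mulfI j21); lra.
have := holomorphic_coord 2 3 hol; sparse_bracket_entries Pbr Jr.
rewrite ?x4 ?v4 => h23.
(* The equation is x_3 j_21 (v_3 - 1/2) = 0; v_3 is 0 for u_1 and 1 for u_3. *)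
have x3 : co X 3 = 0 by apply: (mulfI (mulf_neq0 j21 v3)); lra.
have := holomorphic_coord 3 3 hol; sparse_bracket_entries Pbr Jr.
rewrite ?x3 ?x4 ?v4 => h33.
have x2 : co X 2 = 0 by apply: (mulfI j21); lra.
have := holomorphic_coord 4 3 hol; sparse_bracket_entries Pbr Jr.
rewrite ?x2 ?x3 ?x4 ?v4 => h43.
have x1 : co X 1 = 0 by apply: (mulfI (mulf_neq0 j21 v3)); lra.
exact: notE (soliton0_einstein sol x1 x2 x3 x4).
Qed.

(** Closedness forces q = 2 and the Nijenhuis condition p = 1. For these values holomorphy at u_1
    gives x_3 = x_4 = 0, and holomorphy at u_3 then x_1 = x_2 = 0. *)
Lemma not_soliton_1_3_1_12 p q : ~ realizes (kpair (iso13_1 R)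
    [:: brk 1 4 (u_ 1); brk 2 3 (q *: u_ 1);
        brk 2 4 (- (p * q) *: e_ 1 + (p + q) *: u_ 2);
        brk 3 4 ((1 - q) *: u_ 3)]) br.
Proof.
move=> Pbr.
have [[j13 j14 j23 j24] [j22 j33 j34 j43 j44] _ [j12 _]] :=
  J_shape_13_1 Pbr kah.
have Jr := (j13, j14, j23, j24, j22, j33, j34, j43, j44).
have [c] := omega_closed_134 Pbr Gmet kah; bracket_entries Pbr => c134.
have q2 : q = 2 by apply: (mulfI j12); lra.
have := nijenhuis_coord kah 1 3 2; sparse_bracket_entries Pbr Jr => N132.
have p1 : p = 1 by apply: (mulfI (mulf_neq0 j12 j12)); lra.
have := holomorphic_coord 1 1 hol; sparse_bracket_entries Pbr Jr.
rewrite ?q2 ?p1 => h11.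
have x3 : co X 3 = 0 by apply: (mulfI j12); lra.
have := holomorphic_coord 1 2 hol; sparse_bracket_entries Pbr Jr.
rewrite ?q2 ?p1 => h12.
have x4 : co X 4 = 0 by apply: (mulfI j12); lra.
have := holomorphic_coord 3 1 hol; sparse_bracket_entries Pbr Jr.
rewrite ?q2 ?p1 ?x3 ?x4 => h31.
have x1 : co X 1 = 0 by apply: (mulfI j12); lra.
have := holomorphic_coord 3 2 hol; sparse_bracket_entries Pbr Jr.
rewrite ?q2 ?p1 ?x3 ?x4 => h32.
have x2 : co X 2 = 0 by apply: (mulfI j12); lra.
exact: notE (soliton0_einstein sol x1 x2 x3 x4).
Qed.

End SolitonCases.

(** * Case analysis over the list *)

Theorem theorem4p4 (R : realType) (P : komrakov_pair R)
    (br : {bilinear 'rV[R]_(hdim P + 4) -> 'rV[R]_(hdim P + 4)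
                    -> 'rV[R]_(hdim P + 4)})
    (G : 'M[R]_4) (X : 'rV[R]_4) (lambda : R) :
  listed P -> realizes P br ->
  invariant_metric br G -> metric_cond P G -> ~ einstein br G ->
  ricci_soliton br G X lambda ->
  ~ (exists J : 'M[R]_4, kahler br G J /\ holomorphic br X J).
Proof.
move=> LP Pbr Gmet _ notE sol [J [kah hol]].
(* The bullets follow the order of the constructors of [listed]. *)
case: P / LP br Pbr Gmet notE sol kah hol.
- by move=> br /not_kahler_11_1 nk _ _ _ /nk.
- by move=> p _ br /not_kahler_11_1 nk _ _ _ /nk.
- by move=> br /not_kahler_11_1 nk _ _ _ /nk.
- move=> br Pbr Gmet notE sol kah hol.
  exact: (not_soliton_1_1_2_1 notE sol kah hol Pbr).
- move=> p _ br Pbr Gmet _ _ kah _.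
  by apply: (not_homothety_11_2 Pbr Gmet kah); bracket_entries Pbr;
    rewrite ?subr0 ?addr0.
- move=> br Pbr Gmet notE sol kah hol.
  by apply: (not_soliton_1_1_2_6 notE sol kah hol _ Pbr); rewrite mpart_e.
- move=> br Pbr Gmet notE sol kah hol.
  apply: (not_soliton_1_1_2_6 notE sol kah hol _ Pbr).
  by rewrite mpartN mpart_e oppr0.
- move=> br Pbr Gmet notE sol kah hol.
  apply: (not_soliton_1_3_1_1 notE sol kah hol _ _ Pbr);
    by rewrite mpart_u co_um //= eq_sym invr_neq0 // pnatr_eq0.
- move=> br Pbr Gmet notE sol kah hol.
  apply: (not_soliton_1_3_1_1 notE sol kah hol _ _ Pbr);
    rewrite mpart_u co_um //=; apply/eqP; lra.
- move=> br Pbr _ _ _ kah _; exact: (not_kahler_1_3_1_2 kah Pbr).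
- move=> br Pbr _ _ _ kah _; exact: (not_kahler_1_3_1_3 kah Pbr).
- move=> p _ br Pbr Gmet _ _ kah _.
  have [_ _ Jsq [j12 j21]] := J_shape_13_1 Pbr kah.
  (* This reads p j_21 = 0. With p = 0 the other closedness equation becomes j_12 = j_21, against
     j_11^2 + j_12 j_21 = -1. *)
  have [d] := omega_closed_234 Pbr Gmet kah; bracket_entries Pbr => c234.
  have p0 : p = 0 by apply: (mulfI j21); lra.
  have [c] := omega_closed_134 Pbr Gmet kah; bracket_entries Pbr.
  by rewrite p0 => c134; nra.
(* Only a coefficient of e_1 changes, so the m-components are those of the previous case. *)
- move=> p _ br Pbr Gmet _ _ kah _.
  have [_ _ Jsq [j12 j21]] := J_shape_13_1 Pbr kah.
  have [d] := omega_closed_234 Pbr Gmet kah; bracket_entries Pbr => c234.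
  have p0 : p = 0 by apply: (mulfI j21); lra.
  have [c] := omega_closed_134 Pbr Gmet kah; bracket_entries Pbr.
  by rewrite p0 => c134; nra.
- move=> br Pbr Gmet _ _ kah _.
  have [_ _ Jsq _] := J_shape_13_1 Pbr kah.
  (* Again j_12 = j_21. *)
  by have [c] := omega_closed_134 Pbr Gmet kah; bracket_entries Pbr; nra.
- move=> br Pbr Gmet _ _ kah _.
  have [_ _ _ [_ /eqP j21]] := J_shape_13_1 Pbr kah.
  have [c] := omega_closed_234 Pbr Gmet kah; bracket_entries Pbr => c234.
  by apply: j21; lra.
- move=> br Pbr Gmet _ _ kah _.
  have [_ _ _ [/eqP j12 _]] := J_shape_13_1 Pbr kah.
  (* Here, as in most cases below, closedness says that a nonzero multiple of j_12 is 0. *)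
  have [c] := omega_closed_134 Pbr Gmet kah; bracket_entries Pbr => c134.
  by apply: j12; lra.
- move=> p pn _ br Pbr Gmet _ _ kah _.
  have [_ _ _ [j12 _]] := J_shape_13_1 Pbr kah.
  have [c] := omega_closed_134 Pbr Gmet kah; bracket_entries Pbr => c134.
  by apply/pn/(mulfI j12); lra.
- move=> br Pbr Gmet _ _ kah _.
  have [_ _ _ [/eqP j12 _]] := J_shape_13_1 Pbr kah.
  have [c] := omega_closed_134 Pbr Gmet kah; bracket_entries Pbr => c134.
  by apply: j12; lra.
- move=> p q br Pbr Gmet notE sol kah hol.
  exact: (not_soliton_1_3_1_12 Gmet notE sol kah hol Pbr).
- move=> p _ br Pbr Gmet _ _ kah _.
  have [_ _ _ [/eqP j12 _]] := J_shape_13_1 Pbr kah.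
  have [c] := omega_closed_134 Pbr Gmet kah; bracket_entries Pbr => c134.
  by apply: j12; lra.
- move=> p _ _ br Pbr Gmet _ _ kah _.
  exact: (not_kahler_1_3_1_14 Gmet kah Pbr).
- move=> br Pbr Gmet _ _ kah _.
  have [_ _ _ [/eqP j12 _]] := J_shape_13_1 Pbr kah.
  have [c] := omega_closed_134 Pbr Gmet kah; bracket_entries Pbr => c134.
  by apply: j12; lra.
- move=> br Pbr Gmet _ _ kah _.
  have [_ _ _ [/eqP j12 _]] := J_shape_13_1 Pbr kah.
  have [c] := omega_closed_134 Pbr Gmet kah; bracket_entries Pbr => c134.
  by apply: j12; lra.
- move=> p _ pn br Pbr Gmet _ _ kah _.
  have [_ _ _ [j12 _]] := J_shape_13_1 Pbr kah.
  have [c] := omega_closed_134 Pbr Gmet kah; bracket_entries Pbr => c134.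
  (* The coefficient of j_12 is 2 - p. *)
  have p2 : p = 2 by apply: (mulfI j12); lra.
  by apply: pn; rewrite p2 subrr mulr0.
- move=> br Pbr Gmet _ _ kah _.
  have [_ _ _ [/eqP j12 _]] := J_shape_13_1 Pbr kah.
  have [c] := omega_closed_134 Pbr Gmet kah; bracket_entries Pbr => c134.
  by apply: j12; lra.
- move=> br Pbr Gmet _ _ kah _.
  have [_ _ _ [/eqP j12 _]] := J_shape_13_1 Pbr kah.
  (* The j_21 terms cancel, since [u_2, u_3] = u_2 and [u_3, u_4] = u_4; what remains is - j_12 / 2
     = 0. *)
  have [c] := omega_closed_234 Pbr Gmet kah; bracket_entries Pbr => c234.
  by apply: j12; lra.
- by move=> br /not_kahler_14_1 nk _ _ _ /nk.
- by move=> p r br /not_kahler_14_1 nk _ _ _ /nk.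
- by move=> p r _ br /not_kahler_14_1 nk _ _ _ /nk.
- by move=> r br /not_kahler_14_1 nk _ _ _ /nk.
- by move=> br /not_kahler_14_1 nk _ _ _ /nk.
- by move=> br /not_kahler_14_1 nk _ _ _ /nk.
- by move=> br /not_kahler_14_1 nk _ _ _ /nk.
- by move=> br /not_kahler_14_1 nk _ _ _ /nk.
- by move=> br /not_kahler_14_1 nk _ _ _ /nk.
- by move=> p _ _ br /not_kahler_22_1 nk _ _ _ /nk.
- by move=> br /not_kahler_22_1 nk _ _ _ /nk.
- by move=> r s h _ _ br /not_kahler_25_1 nk _ _ _ /nk.
- by move=> r h _ _ br /not_kahler_25_1 nk _ _ _ /nk.
- by move=> p r s _ _ _ br /not_kahler_25_2 nk _ _ _ /nk.
- by move=> p _ br /not_kahler_33_1 nk _ _ _ /nk.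
- by move=> p _ br /not_kahler_33_2 nk _ _ _ /nk.
Qed.
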